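(* There is an adversarially robust $F_2$ estimation algorithm for insertion-only streams of length $m$ that guarantees, with probability at least $1-\frac{1}{m}$, that after every update $i$ its output lies in $(1\pm\alpha)\|f^{(i)}\|_2^2$, even against an adaptive adversary. The space used by the algorithm is $\tilde{O}\left(\frac{1}{\alpha^{2.5}}\log^4(m)\right)$.
   Context: A stream is a sequence of updates $(a_1,\Delta_1),\dots,(a_m,\Delta_m)$ with $a_i\in[n]$, $\Delta_i\in\mathbb{Z}$; it is insertion-only if all $\Delta_i>0$. Its frequency vector after $i$ updates is $f^{(i)}\in\mathbb{R}^n$ with $f^{(i)}_\ell=\sum_{j\le i:\,a_j=\ell}\Delta_j$; $F_2$ estimation asks, after every update $i$, for an estimate of $\|f^{(i)}\|_2^2=\sum_\ell|f^{(i)}_\ell|^2$. Adversarial robustness: each update may be chosen by an adversary as a function of all previous updates and all previous outputs of the algorithm. $\tilde O$ hides polylogarithmic factors (here in $1/\alpha$ and lower-order factors). Standing assumption: $\log m=\Theta(\log n)$ and values polynomially bounded in $n$. *)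

(* Defs.v *)
From HB Require Import structures.
From mathcomp Require Import all_boot all_order all_algebra.
From mathcomp Require Import reals exp.

Set Implicit Arguments.
Unset Strict Implicit.
Unset Printing Implicit Defensive.

Import Order.TTheory GRing.Theory Num.Theory.

Local Open Scope ring_scope.

(* An update (a, Delta); coordinates are numbered from 0. *)
Definition update (n : nat) : Type := ('I_n * int)%type.

Definition frequency (R : realType) (n : nat) (us : seq (update n)) : 'rV[R]_n :=
  \row_l \sum_(u <- us | u.1 == l) u.2%:~R.

Definition F2 (R : realType) (n : nat) (us : seq (update n)) : R :=
  \sum_l `|frequency R us 0 l| ^+ 2.

Definition insertion_only (n : nat) (us : seq (update n)) : bool :=
  all (fun u => 0 < u.2) us.

Definition values_bounded (n : nat) (B : nat) (us : seq (update n)) : bool :=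
  all (fun u => `|u.2| <= B%:Z) us.

Record fin_distr (R : realType) (S : finType) := FinDistr {
  mass :> S -> R;
  mass_ge0 : forall s, 0 <= mass s;
  mass_sum1 : \sum_s mass s = 1
}.

(* A state holds everything that is remembered from one update to the next,
   including any random bits that are used again later; the coins tossed while
   processing an update are those of [alg_step].  Only [alg_output] of the
   current state is revealed. *)
Record stream_alg (R : realType) (n : nat) := StreamAlg {
  alg_state : finType;
  alg_init : fin_distr R alg_state;
  alg_step : alg_state -> update n -> fin_distr R alg_state;
  alg_output : alg_state -> R
}.

(* Number of bits needed to store a state: least e with #|state| <= 2 ^ e. *)
Definition space_bits (R : realType) (n : nat) (A : stream_alg R n) : nat :=
  up_log 2 #|alg_state A|.

(* The next update, as a function of the previous updates and outputs. *)
Definition adversary (R : realType) (n : nat) : Type :=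
  seq (update n) -> seq R -> update n.

(* First k updates of the interaction in which the algorithm's successive
   outputs are z; the update of index j sees only the first j outputs. *)
Fixpoint adaptive_stream (R : realType) (n : nat) (adv : adversary R n)
    (z : seq R) (k : nat) : seq (update n) :=
  if k is j.+1 then
    let us := adaptive_stream adv z j in rcons us (adv us (take j z))
  else [::].

Definition adaptive_update (R : realType) (n : nat) (adv : adversary R n)
    (z : seq R) (j : nat) : update n :=
  adv (adaptive_stream adv z j) (take j z).

Definition outputs (R : realType) (n : nat) (A : stream_alg R n)
    (t : seq (alg_state A)) : seq R :=
  [seq alg_output s | s <- t].

(* Probability that the interaction of A with adv starts in state s0 and that t
   lists the states reached after each of the m updates. *)
Definition run_prob (R : realType) (n m : nat) (A : stream_alg R n)
    (adv : adversary R n) (s0 : alg_state A) (t : m.-tuple (alg_state A)) : R :=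
  alg_init A s0 *
  \prod_(j < m) alg_step (nth s0 (s0 :: t) j)
                         (adaptive_update adv (outputs t) j) (tnth t j).

Definition run_accurate (R : realType) (n m : nat) (A : stream_alg R n)
    (adv : adversary R n) (alpha : R) (t : m.-tuple (alg_state A)) : bool :=
  [forall j : 'I_m,
     let F := F2 R (adaptive_stream adv (outputs t) j.+1) in
     (1 - alpha) * F <= alg_output (tnth t j) <= (1 + alpha) * F].

Definition success_prob (R : realType) (n m : nat) (A : stream_alg R n)
    (adv : adversary R n) (alpha : R) : R :=
  \sum_(s0 : alg_state A)
    \sum_(t : m.-tuple (alg_state A) | run_accurate adv alpha t)
      run_prob adv s0 t.

(* Robustness on insertion-only streams of length m with increments at most B. *)
Definition robust_F2 (R : realType) (n m B : nat) (alpha : R)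
    (A : stream_alg R n) : Prop :=
  forall adv : adversary R n,
    (forall z : seq R, insertion_only (adaptive_stream adv z m) &&
                       values_bounded B (adaptive_stream adv z m)) ->
    1 - m%:R^-1 <= success_prob m A adv alpha.

(* f = O(g * polylog(g)), uniformly over the parameters i satisfying D; the 2
   keeps the logarithm bounded away from 0 where g is small. *)
Definition soft_O (R : realType) (I : Type) (D : I -> Prop) (f g : I -> R) : Prop :=
  exists (C : R) (k : nat), 0 < C /\
    forall i, D i -> f i <= C * (g i * ln (2 + g i) ^+ k).

(* The regime log m = Theta(log n), with explicit constants c1 and c2. *)
Definition admissible (R : realType) (c1 c2 : R) (n m : nat) (alpha : R) : Prop :=
  [/\ (1 < n)%N, (1 < m)%N,
      c1 * ln n%:R <= ln m%:R <= c2 * ln n%:R &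
      0 < alpha < 1].

(* Main.v *)
Require Import Defs.
From mathcomp Require Import all_boot all_order all_algebra.
From mathcomp Require Import reals exp boolp.
From mathcomp Require Import ring lra zify.

Set Implicit Arguments.
Unset Strict Implicit.
Unset Printing Implicit Defensive.

Import Order.TTheory GRing.Theory Num.Theory.

Local Open Scope ring_scope.

(** Sketch switching with two accuracies.  Put b = sqrt alpha.  "Strong" copies
    of the AMS sketch (about alpha^-2 rows each) estimate F2 afresh each time it
    has grown by a factor 1 + b; in between, "weak" copies (about alpha^-1.5 rows
    each) estimate only the growth F2(f) - F2(u) = <f - u, f + u> since the last
    strong estimate at u, and the output changes only when it is off by a factor
    1 + alpha / 4.  As |f - u|^2 is at most the growth, alpha^-1.5 rows give
    additive error alpha |u|^2.  A copy is read only through its own change of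
    output, after which it is never used again; up to then the stream does not
    depend on its seed, so oblivious accuracy suffices against an adaptive
    adversary.  There are about alpha^-0.5 log m strong and alpha^-1 log m weak
    copies, hence alpha^-2.5 log m rows, each repeated O(log m) times for a median
    and each holding O(log m) bits. *)

(** * Counting over product seed spaces *)

Record lens (Omega W : finType) := Lens {
  lens_get : Omega -> W;
  lens_set : Omega -> W -> Omega;
  lens_getK : forall o s, lens_get (lens_set o s) = s;
  lens_setK : forall o s s', lens_set (lens_set o s) s' = lens_set o s';
  lens_get_set : forall o, lens_set o (lens_get o) = o
}.

Section FfunLens.
Variables (I : eqType) (J W : finType).

Definition ffun_set (i : J) (o : {ffun J -> W}) (s : W) : {ffun J -> W} :=
  [ffun j => if j == i then s else o j].

Lemma ffun_set_getK i o s : ffun_set i o s i = s.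
Proof. by rewrite ffunE eqxx. Qed.

Lemma ffun_set_setK i o s s' : ffun_set i (ffun_set i o s) s' = ffun_set i o s'.
Proof. by apply/ffunP => j; rewrite !ffunE; case: eqP. Qed.

Lemma ffun_set_get i o : ffun_set i o (o i) = o.
Proof. by apply/ffunP => j; rewrite ffunE; case: eqP => // ->. Qed.

Definition ffun_lens (i : J) : lens {ffun J -> W} W :=
  @Lens {ffun J -> W} W (fun o => o i) (ffun_set i)
    (ffun_set_getK i) (ffun_set_setK i) (ffun_set_get i).

End FfunLens.

Section FstSndLens.
Variables (O1 O2 W : finType).

Program Definition fst_lens (l : lens O1 W) : lens (O1 * O2)%type W :=
  @Lens (O1 * O2)%type W (fun o => lens_get l o.1)
    (fun o s => (lens_set l o.1 s, o.2)) _ _ _.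
Next Obligation. by move=> l [o1 o2] s /=; rewrite lens_getK. Qed.
Next Obligation. by move=> l [o1 o2] s s' /=; rewrite lens_setK. Qed.
Next Obligation. by move=> l [o1 o2] /=; rewrite lens_get_set. Qed.

Program Definition snd_lens (l : lens O2 W) : lens (O1 * O2)%type W :=
  @Lens (O1 * O2)%type W (fun o => lens_get l o.2)
    (fun o s => (o.1, lens_set l o.2 s)) _ _ _.
Next Obligation. by move=> l [o1 o2] s /=; rewrite lens_getK. Qed.
Next Obligation. by move=> l [o1 o2] s s' /=; rewrite lens_setK. Qed.
Next Obligation. by move=> l [o1 o2] /=; rewrite lens_get_set. Qed.

End FstSndLens.

Section Resampling.
Variables (R : realType) (Omega W : finType) (l : lens Omega W).

Lemma sum_resample (h : Omega -> R) :
  (\sum_o h o) * #|W|%:R = \sum_o \sum_s h (lens_set l o s).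
Proof.
pose f (p : Omega * W) := (lens_set l p.1 p.2, lens_get l p.1).
have fK : involutive f.
  by case=> o s; rewrite /f /= lens_getK lens_setK lens_get_set.
rewrite pair_big /= (reindex_inj (inv_inj fK)) /=.
under [RHS]eq_bigr => p _ do rewrite lens_setK lens_get_set.
rewrite -(pair_big xpredT xpredT (fun o (_ : W) => h o)) /= mulr_suml.
by apply: eq_bigr => o _; rewrite sumr_const mulr_natr.
Qed.

(* An event [A] that reads the component only through a value [G] on which all
   outcomes of [A] agree leaves the component uniform. *)
Lemma card_resample (X : Type) (A : pred Omega) (G : Omega -> X)
    (Bad : X -> pred W) (delta : R) :
  (forall o s, A o -> A (lens_set l o s) -> G o = G (lens_set l o s)) ->
  (forall o, A o -> #|[pred s | Bad (G o) s]|%:R <= delta * #|W|%:R) ->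
  0 <= delta ->
  #|[pred o | A o && Bad (G o) (lens_get l o)]|%:R <= delta * #|Omega|%:R.
Proof.
move=> Gagree Bbound d0.
have [W0|/card_gt0P[w0 _]] := posnP #|W|.
  rewrite eq_card0 ?mulr_ge0 ?ler0n// => o.
  by have := fintype0 (lens_get l o); rewrite W0.
have Wp : 0 < #|W|%:R :> R by rewrite ltr0n; apply/card_gt0P; exists w0.
rewrite -(ler_pM2r Wp) -sum1_card natr_sum.
rewrite big_mkcond /= (sum_resample (fun o => if A o && Bad (G o) (lens_get l o) then 1 else 0)).
rewrite mulrAC -mulrA.
have -> : delta * (#|W|%:R * #|Omega|%:R) = \sum_(o : Omega) delta * #|W|%:R.
  by rewrite sumr_const -[RHS]mulr_natr mulrA.
apply: ler_sum => o _.
under eq_bigr => s _ do rewrite lens_getK.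
have [[s0 As0]|nA] := pselect (exists s, A (lens_set l o s)); last first.
  rewrite big1 ?mulr_ge0 ?ler0n// => s _; case: ifP => // /andP[As _].
  by case: nA; exists s.
apply: le_trans (Bbound _ As0).
rewrite -sumr_const [leRHS]big_mkcond /=; apply: ler_sum => s _.
case: ifP => [/andP[As]|_]; last by case: ifP.
by rewrite inE; have := Gagree _ s As0; rewrite lens_setK => /(_ As) -> ->.
Qed.

End Resampling.

Lemma second_moment_ffun (R : realType) (W : finType) (r : nat) (Y : W -> R) :
  \sum_s Y s = 0 ->
  (\sum_(o : {ffun 'I_r -> W}) (\sum_i Y (o i)) ^+ 2) * #|W|%:R =
  (\sum_s Y s ^+ 2) * (r%:R * #|{ffun 'I_r -> W}|%:R).
Proof.
move=> Y0.
under eq_bigr => o _ do rewrite expr2 big_distrlr /=.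
rewrite exchange_big [LHS]mulr_suml /=.
transitivity (\sum_(i < r) (\sum_s Y s ^+ 2) * #|{ffun 'I_r -> W}|%:R).
  apply: eq_bigr => i _; rewrite (sum_resample (ffun_lens _ i)) /=.
  rewrite [RHS]mulr_natr -sumr_const.
  apply: eq_bigr => o _; rewrite exchange_big /= (bigD1 i) //= [X in _ + X]big1 ?addr0.
    by apply: eq_bigr => s _; rewrite ffun_set_getK expr2.
  move=> j ji.
  under eq_bigr => s _ do rewrite ffun_set_getK [X in _ * Y X]ffunE (negbTE ji).
  by rewrite -mulr_suml Y0 mul0r.
by rewrite sumr_const card_ord -mulr_natl; ring.
Qed.

Lemma chebyshev_card (R : realType) (W : finType) (Y : W -> R) (e p : R) :
  0 <= e -> 0 <= p -> \sum_s Y s ^+ 2 <= p * e * #|W|%:R ->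
  #|[pred s | e < Y s ^+ 2]|%:R <= p * #|W|%:R.
Proof.
move=> e0 p0 H; move: e0; rewrite le_eqVlt => /orP[/eqP e0|e0].
  move: H; rewrite -e0 mulr0 mul0r => H.
  have H' : \sum_s Y s ^+ 2 == 0 by rewrite eq_le H sumr_ge0 // => s _; exact: sqr_ge0.
  rewrite eq_card0 ?mulr_ge0 ?ler0n // => s; rewrite !inE.
  move: H'; rewrite psumr_eq0 => [/allP/(_ s)|i _]; last exact: sqr_ge0.
  by rewrite mem_index_enum => /(_ isT)/implyP/(_ isT)/eqP ->; rewrite ltxx.
rewrite -(ler_pM2r e0) mulrAC; apply: le_trans H.
rewrite -sum1_card natr_sum mulr_suml big_mkcond /=; apply: ler_sum => s _.
by case: ifP => [|_]; [rewrite inE mul1r => /ltW | exact: sqr_ge0].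
Qed.

Lemma card_majority_bad (R : realType) (W : finType) (T : nat) (Bad : pred W) :
  (16 * #|Bad| <= #|W|)%N ->
  #|[pred o : {ffun 'I_T -> W} | (T <= 2 * #|[pred g | Bad (o g)]|)%N]|%:R
    <= (2 ^+ T)^-1 * #|{ffun 'I_T -> W}|%:R :> R.
Proof.
move=> HB; pose h (w : W) : R := if Bad w then 16 else 1.
have prodh (o : {ffun 'I_T -> W}) : \prod_g h (o g) = 16 ^+ #|[pred g | Bad (o g)]|.
  by rewrite -prodr_const [RHS]big_mkcond /=; apply: eq_bigr => g _; rewrite inE.
have sumh : \sum_w h w <= 2 * #|W|%:R.
  have -> : \sum_w h w = #|W|%:R + 15 * #|Bad|%:R.
    have -> : #|Bad|%:R = \sum_w (Bad w)%:R :> R.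
      by rewrite -sum1_card natr_sum [LHS]big_mkcond; apply: eq_bigr => w _; rewrite unfold_in; case: (Bad w).
    have -> : #|W|%:R = \sum_(w : W) 1 :> R by rewrite sumr_const.
    rewrite mulr_sumr -big_split /=; apply: eq_bigr => w _.
    rewrite /h; case: (Bad w) => /=; lra.
  have : 16 * #|Bad|%:R <= #|W|%:R :> R by rewrite -natrM ler_nat.
  have : 0 <= #|Bad|%:R :> R by rewrite ler0n.
  lra.
have D : \sum_(o : {ffun 'I_T -> W}) \prod_g h (o g) <= 2 ^+ T * #|W|%:R ^+ T.
  rewrite -(bigA_distr_bigA (fun (_ : 'I_T) w => h w)) /= prodr_const card_ord -exprMn.
  by apply: lerXn2r => //; rewrite ?nnegrE ?mulr_ge0 ?ler0n ?sumr_ge0 // => w _; rewrite /h; case: ifP.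
rewrite card_ffun card_ord natrX.
have p4 : 0 < 4 ^+ T :> R by apply: exprn_gt0; lra.
have p2 : 0 < 2 ^+ T :> R by apply: exprn_gt0; lra.
have e4 : 4 ^+ T = 2 ^+ T * 2 ^+ T :> R by rewrite -exprMn; congr (_ ^+ _); lra.
rewrite -(ler_pM2r p4) -sum1_card natr_sum mulr_suml.
have -> : (2 ^+ T)^-1 * #|W|%:R ^+ T * 4 ^+ T = 2 ^+ T * #|W|%:R ^+ T :> R.
  by rewrite e4; field; rewrite gt_eqF.
apply: le_trans D; rewrite big_mkcond /=; apply: ler_sum => o _.
rewrite prodh; case: ifP => [|_]; last by apply: exprn_ge0; lra.
rewrite inE mul1r => H.
have -> : 16 = 4 ^+ 2 :> R by lra.
by rewrite -exprM; apply: ler_weXn2l; first lra.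
Qed.

(** * Sign vectors with matching fourth moments *)

Section Signs.
Variable R : realType.

Definition dot_bit (d : nat) (s c : 'rV[bool]_d) : bool := (s *m c^T) 0 0.

Lemma dot_bitDl d (s s' c : 'rV[bool]_d) :
  dot_bit (s + s') c = dot_bit s c (+) dot_bit s' c.
Proof. by rewrite /dot_bit mulmxDl mxE. Qed.

Lemma dot_bitDr d (s c c' : 'rV[bool]_d) :
  dot_bit s (c + c') = dot_bit s c (+) dot_bit s c'.
Proof. by rewrite /dot_bit linearD mulmxDr mxE. Qed.

Lemma addbb_mx d (c : 'rV[bool]_d) : c + c = 0.
Proof. by apply/rowP => j; rewrite !mxE; case: (c 0 j). Qed.

Lemma sum_dot_sign d (c : 'rV[bool]_d) :
  \sum_(s : 'rV[bool]_d) (-1) ^+ (dot_bit s c) = (#|'rV[bool]_d| * (c == 0%R))%:R :> R.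
Proof.
have [->|c0] := eqVneq c 0.
  rewrite muln1 -sumr_const; apply: eq_bigr => s _.
  by rewrite /dot_bit trmx0 mulmx0 mxE expr0.
rewrite muln0; have [j cj] : exists j, c 0 j.
  case/rV0Pn: c0 => j; case E: (c 0 j) => // _; by exists j.
have addj : involutive (fun s : 'rV[bool]_d => s + delta_mx 0 j).
  by move=> s; rewrite -addrA addbb_mx addr0.
have dj : dot_bit (delta_mx 0 j) c = true.
  by rewrite /dot_bit -rowE !mxE.
set S := \sum_s _; suff : S = - S by lra.
rewrite {1}/S (reindex_inj (inv_inj addj)) /= -sumrN; apply: eq_bigr => s _.
by rewrite dot_bitDl dj signr_addb mulrN1.
Qed.

Lemma exists_sidon (n d : nat) : (n ^ 3 <= 2 ^ d)%N ->
  exists c : nat -> 'rV[bool]_d, forall i j k l,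
    (i < n)%N -> (j < i)%N -> (k < i)%N -> (l < i)%N -> c i != c j + c k + c l.
Proof.
elim: n => [|n IH] nd; first by exists (fun _ => 0).
have n3 : (n ^ 3 < 2 ^ d)%N by apply: leq_trans nd; rewrite ltn_exp2r.
have [c Hc] := IH (ltnW n3).
pose f (p : 'I_n * 'I_n * 'I_n) := c p.1.1 + c p.1.2 + c p.2.
have [v Hv] : exists v, v \notin codom f.
  apply/existsP; rewrite -negb_forall; apply/negP => /forallP full.
  have : (#|'rV[bool]_d| <= #|codom f|)%N by apply: subset_leq_card; apply/subsetP.
  rewrite leqNgt (leq_ltn_trans (card_size _)) // size_codom !card_prod card_ord card_mx card_bool mul1n.
  by move: n3; rewrite !expnS expn0 muln1 mulnA.
exists (fun i => if i == n then v else c i) => i j k l.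
rewrite ltnS leq_eqVlt => /orP[/eqP ->|ltin] ji ki li.
  rewrite eqxx (ltn_eqF ji) (ltn_eqF ki) (ltn_eqF li).
  apply: contraNneq Hv => ->.
  exact: (codom_f f (Ordinal ji, Ordinal ki, Ordinal li)).
rewrite (ltn_eqF ltin) !ltn_eqF ?(ltn_trans _ ltin) //; exact: Hc.
Qed.

Lemma sidon_pairing (n d : nat) (c : nat -> 'rV[bool]_d) :
  (forall i j k l, (i < n)%N -> (j < i)%N -> (k < i)%N -> (l < i)%N ->
     c i != c j + c k + c l) ->
  (forall i j : 'I_n, c i + c j = 0 -> i = j) /\
  (forall i j k l : 'I_n, c i + c j + c k + c l = 0 ->
     [\/ i = j /\ k = l, i = k /\ j = l | i = l /\ j = k]).
Proof.
move=> Hc.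
have eq0 (x y : 'rV[bool]_d) : x + y = 0 -> x = y.
  by move=> e; rewrite -[x]addr0 -(addbb_mx y) addrA e add0r.
have inj (i j : 'I_n) : c i = c j -> i = j.
  move=> e; apply: val_inj; case: (ltngtP i j) => // [lt|lt].
    have := Hc j i i i (ltn_ord j) lt lt lt.
    by rewrite addbb_mx add0r e eqxx.
  have := Hc i j j j (ltn_ord i) lt lt lt.
  by rewrite addbb_mx add0r e eqxx.
have top (i j k l : 'I_n) : c i + c j + c k + c l = 0 ->
    (j < i)%N -> (k < i)%N -> (l < i)%N -> False.
  move=> e ji ki li; have := Hc i j k l (ltn_ord i) ji ki li.
  by rewrite -!addrA in e *; rewrite (eq0 _ _ e) eqxx.
have pair (i k l : 'I_n) : c i + c i + c k + c l = 0 -> k = l.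
  by rewrite addbb_mx add0r => /eq0/inj.
split=> [i j /eq0/inj //|i j k l e].
have e2 : c i + c k + c j + c l = 0 by rewrite -e; congr (_ + _); rewrite addrAC.
have e3 : c i + c l + c j + c k = 0.
  by rewrite -e -!addrA; congr (_ + _); rewrite addrC addrA.
have e4 : c j + c i + c k + c l = 0 by rewrite [c j + _]addrC.
have e5 : c k + c i + c j + c l = 0 by rewrite [c k + _]addrC.
have e6 : c l + c i + c j + c k = 0 by rewrite [c l + _]addrC.
have e7 : c j + c k + c i + c l = 0 by rewrite -e4; congr (_ + _); rewrite addrAC.
have e8 : c j + c l + c i + c k = 0 by rewrite -e4 -!addrA; congr (_ + _); rewrite addrC addrA.
have e9 : c k + c l + c i + c j = 0 by rewrite -e5 -!addrA; congr (_ + _); rewrite addrC addrA.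
have [ij|ij] := eqVneq i j.
  by constructor 1; split=> //; apply: (pair i); rewrite {2}ij.
have [ik|ik] := eqVneq i k.
  by constructor 2; split=> //; apply: (pair i); rewrite {2}ik.
have [il|il] := eqVneq i l.
  by constructor 3; split=> //; apply: (pair i); rewrite {2}il.
have [jk|jk] := eqVneq j k.
  by move: il; rewrite (pair j i l) ?eqxx // {2}jk.
have [jl|jl] := eqVneq j l.
  by move: ik; rewrite (pair j i k) ?eqxx // {2}jl.
have [kl|kl] := eqVneq k l.
  by move: ij; rewrite (pair k i j) ?eqxx // {2}kl.
exfalso; move: ij ik il jk jl kl; rewrite -!val_eqE /= => ij ik il jk jl kl.
have : [|| (j < i) && (k < i) && (l < i), (i < j) && (k < j) && (l < j),
           (i < k) && (j < k) && (l < k) | (i < l) && (j < l) && (k < l)]%N by lia.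
by case/or4P => /andP[/andP[a b] c']; [exact: (top i j k l)|exact: (top j i k l)
  |exact: (top k i j l)|exact: (top l i j k)].
Qed.

Lemma exists_signs (n d : nat) : (n ^ 3 <= 2 ^ d)%N ->
  exists z : 'rV[bool]_d -> 'I_n -> bool,
    (forall i j, \sum_s (-1) ^+ (z s i) * (-1) ^+ (z s j)
       = (#|'rV[bool]_d| * (i == j))%:R :> R) /\
    (forall i j k l, \sum_s (-1) ^+ (z s i) * (-1) ^+ (z s j) * (-1) ^+ (z s k) * (-1) ^+ (z s l)
       <= (#|'rV[bool]_d| * ((i == j) * (k == l) + (i == k) * (j == l) + (i == l) * (j == k)))%:R :> R).
Proof.
move=> /exists_sidon[c /sidon_pairing[c2 c4]].
exists (fun s i => dot_bit s (c i)); split=> [i j|i j k l].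
  under eq_bigr => s _ do rewrite -signr_addb -dot_bitDr.
  rewrite sum_dot_sign; congr (_ * nat_of_bool _)%:R; apply/eqP/eqP => [/c2 //|->].
  exact: addbb_mx.
under eq_bigr => s _ do rewrite -!signr_addb -!dot_bitDr.
rewrite sum_dot_sign ler_nat leq_mul2l; apply/orP; right.
case: eqP => // /c4[[-> ->]|[-> ->]|[-> ->]]; rewrite !eqxx; lia.
Qed.

End Signs.

(** * The bilinear second moment *)

Section Bilinear.
Variables (R : realType) (n : nat) (V : finType) (z : V -> 'I_n -> R).
Hypothesis z2 : forall i j, \sum_s z s i * z s j = (#|V| * (i == j))%:R.
Hypothesis z4 : forall i j k l, \sum_s z s i * z s j * z s k * z s l <=
  (#|V| * ((i == j) * (k == l) + (i == k) * (j == l) + (i == l) * (j == k)))%:R.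

Definition lin (v : 'I_n -> R) (s : V) : R := \sum_i v i * z s i.

Lemma sum_lin_mul (v w : 'I_n -> R) :
  \sum_s lin v s * lin w s = #|V|%:R * \sum_i v i * w i.
Proof.
under eq_bigr => s _ do rewrite big_distrlr /=.
rewrite exchange_big mulr_sumr; apply: eq_bigr => i _.
rewrite exchange_big /= (bigD1 i) //= [X in _ + X]big1 ?addr0 => [|j ji].
  under eq_bigr => s _ do rewrite mulrACA.
  by rewrite -mulr_sumr z2 eqxx muln1 mulrC.
under eq_bigr => s _ do rewrite mulrACA.
by rewrite -mulr_sumr z2 eq_sym (negbTE ji) muln0 mulr0.
Qed.

Lemma sum_delta (f : 'I_n -> R) i : \sum_k f k * (i == k)%:R = f i.
Proof.
rewrite (bigD1 i) //= eqxx mulr1 big1 ?addr0 // => j ji.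
by rewrite eq_sym (negbTE ji) mulr0.
Qed.

Lemma sum_lin_mul_sq (v w : 'I_n -> R) :
  (forall i, 0 <= v i) -> (forall i, 0 <= w i) ->
  \sum_s (lin v s * lin w s) ^+ 2 <=
    #|V|%:R * (3 * (\sum_i v i ^+ 2) * (\sum_i w i ^+ 2)).
Proof.
move=> v0 w0.
have -> : \sum_s (lin v s * lin w s) ^+ 2 =
    \sum_i \sum_j \sum_k \sum_l (v i * v j * w k * w l) *
      (\sum_s z s i * z s j * z s k * z s l).
  transitivity (\sum_s \sum_i \sum_j \sum_k \sum_l
      (v i * v j * w k * w l) * (z s i * z s j * z s k * z s l)).
    apply: eq_bigr => s _; rewrite exprMn !expr2 /lin big_distrlr [X in _ * X]big_distrlr /=.
    rewrite mulr_suml; apply: eq_bigr => i _; rewrite mulr_suml; apply: eq_bigr => j _.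
    rewrite mulr_sumr; apply: eq_bigr => k _; rewrite mulr_sumr; apply: eq_bigr => l _.
    by ring.
  rewrite exchange_big; apply: eq_bigr => i _; rewrite exchange_big; apply: eq_bigr => j _.
  rewrite exchange_big; apply: eq_bigr => k _; rewrite exchange_big; apply: eq_bigr => l _.
  by rewrite mulr_sumr.
apply: (@le_trans _ _ (\sum_i \sum_j \sum_k \sum_l #|V|%:R * ((v i * v j * w k * w l) *
   ((i == j)%:R * (k == l)%:R + (i == k)%:R * (j == l)%:R + (i == l)%:R * (j == k)%:R)))).
  apply: ler_sum => i _; apply: ler_sum => j _; apply: ler_sum => k _; apply: ler_sum => l _.
  rewrite mulrCA; apply: ler_wpM2l; first by rewrite !mulr_ge0.
  by apply: le_trans (z4 _ _ _ _) _; rewrite natrM !natrD !natrM.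
have -> : \sum_i \sum_j \sum_k \sum_l #|V|%:R * ((v i * v j * w k * w l) *
   ((i == j)%:R * (k == l)%:R + (i == k)%:R * (j == l)%:R + (i == l)%:R * (j == k)%:R))
  = #|V|%:R * \sum_i \sum_j (v i * v i * (w j * w j) + 2 * (v i * w i * (v j * w j))).
  rewrite mulr_sumr; apply: eq_bigr => i _; rewrite mulr_sumr.
  transitivity (\sum_j #|V|%:R * (v i * v j * (i == j)%:R * (\sum_k w k * w k) +
      2 * (v i * v j * w i * w j))).
    apply: eq_bigr => j _.
    under eq_bigr => k _ do rewrite -mulr_sumr.
    rewrite -mulr_sumr; congr (_ * _).
    transitivity (\sum_k (v i * v j * (i == j)%:R * (w k * w k) +
       (v i * v j * w j * w k * (i == k)%:R + v i * v j * w i * w k * (j == k)%:R))).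
      apply: eq_bigr => k _.
      transitivity (\sum_l ((v i * v j * (i == j)%:R * w k * w l) * (k == l)%:R +
        ((v i * v j * (i == k)%:R * w k * w l) * (j == l)%:R +
        (v i * v j * (j == k)%:R * w k * w l) * (i == l)%:R))).
        by apply: eq_bigr => l _; ring.
      by rewrite !big_split /= !sum_delta; ring.
    by rewrite !big_split /= !sum_delta -mulr_sumr; ring.
  rewrite -!mulr_sumr; congr (_ * _); rewrite !big_split /= -mulr_suml sum_delta.
  by rewrite -[X in _ = X + _]mulr_sumr; congr (_ + _); apply: eq_bigr => j _; ring.
apply: ler_wpM2l; first exact: ler0n.
have -> : 3 * (\sum_i v i ^+ 2) * (\sum_i w i ^+ 2) =
    \sum_i \sum_j (v i * v i * (w j * w j) +
       (v i ^+ 2 * w j ^+ 2 + v j ^+ 2 * w i ^+ 2)).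
  have E : (\sum_i v i ^+ 2) * (\sum_i w i ^+ 2) = \sum_i \sum_j v i ^+ 2 * w j ^+ 2.
    by rewrite big_distrlr.
  under [RHS]eq_bigr => i _ do rewrite !big_split /=.
  rewrite !big_split /= [X in _ = _ + (_ + X)]exchange_big /= -E.
  by ring.
apply: ler_sum => i _; apply: ler_sum => j _; rewrite lerD2l.
have := sqr_ge0 (v i * w j - v j * w i); lra.
Qed.

End Bilinear.

(** * Medians *)

Section Median.
Variables (R : realType) (T : nat).
Implicit Type x : 'I_T.+1 -> R.

Definition median_index x : 'I_T.+1 :=
  [arg max_(g > [arg min_(g < ord0) x g]%O | (T.+1 < 2 * #|[pred h | (x g <= x h)%R]|)%N) x g]%O.

Definition median x : R := x (median_index x).

Lemma median_majority x (P : pred R) :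
  (forall a b c, P a -> P c -> a <= b <= c -> P b) ->
  (2 * #|[pred g | ~~ P (x g)]| < T.+1)%N -> P (median x).
Proof.
move=> convP badP.
have cC : (#|[pred g | P (x g)]| + #|[pred g | ~~ P (x g)]| = T.+1)%N.
  by rewrite -[RHS]card_ord -(cardC [pred g | P (x g)]); congr (_ + _)%N; apply: eq_card.
have maj : (T.+1 < 2 * #|[pred g | P (x g)]|)%N by lia.
have [g0 Pg0] : exists g, P (x g).
  have /card_gt0P[g] : (0 < #|[pred g | P (x g)]|)%N by lia.
  by rewrite inE => Pg; exists g.
rewrite /median /median_index; case: Order.TotalTheory.arg_maxP.
  case: Order.TotalTheory.arg_minP => // g _ gmin.
  rewrite (_ : #|_| = T.+1); first by lia.
  by rewrite -[RHS]card_ord; apply: eq_card => h; rewrite !inE gmin.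
move=> g majg gmax.
have [h [Ph gh]] : exists h, P (x h) /\ x g <= x h.
  have /card_gt0P[h] : (0 < #|[predI [pred g | P (x g)] & [pred h | (x g <= x h)%R]]|)%N.
    have := cardUI [pred g | P (x g)] [pred h | x g <= x h].
    have := max_card ([predU [pred g | P (x g)] & [pred h | x g <= x h]]).
    rewrite card_ord => A1 A2; rewrite -(ltn_add2l #|[predU [pred g | P (x g)] & [pred h | (x g <= x h)%R]]|).
    rewrite addn0 A2; apply: leq_ltn_trans A1 _.
    have half a b : (T.+1 < 2 * a -> T.+1 < 2 * b -> T.+1 < a + b)%N by lia.
    exact: half.
  by rewrite !inE => /andP[? ?]; exists h.
case: (@Order.TotalTheory.arg_minP _ _ _ g0 [pred g | P (x g)] x Pg0) => l Pl lmin.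
apply: convP Pl Ph _; rewrite gh andbT; apply: gmax.
apply: leq_trans maj _; rewrite leq_mul2l /=; apply: subset_leq_card.
by apply/subsetP => k; rewrite !inE; exact: lmin.
Qed.

End Median.

(** * Frequencies of insertion-only streams *)

Section Streams.
Variables (R : realType) (n : nat).
Implicit Type us : seq (update n).

Definition stream_mass us : nat := (\sum_(u <- us) `|u.2|)%N.

Lemma stream_mass_cat us us' : stream_mass (us ++ us') = (stream_mass us + stream_mass us')%N.
Proof. by rewrite /stream_mass big_cat. Qed.

Lemma stream_mass_le B us : values_bounded B us -> (stream_mass us <= size us * B)%N.
Proof.
rewrite /stream_mass; elim: us => [|u us IH] /=; first by rewrite big_nil.
by case/andP => ub /IH H; rewrite big_cons mulSn leq_add //; lia.
Qed.

Definition freq us (l : 'I_n) : R := frequency R us 0 l.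

Lemma freqE us l : freq us l = \sum_(u <- us | u.1 == l) u.2%:~R.
Proof. by rewrite /freq mxE. Qed.

Lemma freq_cat us us' l : freq (us ++ us') l = freq us l + freq us' l.
Proof. by rewrite !freqE big_cat. Qed.

Lemma freq_ge0 us l : insertion_only us -> 0 <= freq us l.
Proof.
move=> /allP ius; rewrite freqE big_seq_cond sumr_ge0 // => u /andP[/ius u0 _].
by rewrite ler0z ltW.
Qed.

Lemma F2E us : F2 R us = \sum_l freq us l ^+ 2.
Proof. by apply: eq_bigr => l _; rewrite real_normK ?num_real. Qed.

Lemma F2_ge0 us : 0 <= F2 R us.
Proof. by rewrite F2E sumr_ge0 // => l _; exact: sqr_ge0. Qed.

Lemma F2_nil : F2 R ([::] : seq (update n)) = 0.
Proof. by rewrite F2E big1 // => l _; rewrite freqE big_nil expr0n. Qed.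

Lemma insertion_only_cat us us' :
  insertion_only (us ++ us') = insertion_only us && insertion_only us'.
Proof. exact: all_cat. Qed.

Lemma F2_cat_le us us' : insertion_only (us ++ us') -> F2 R us <= F2 R (us ++ us').
Proof.
rewrite insertion_only_cat => /andP[i1 i2]; rewrite !F2E; apply: ler_sum => l _.
by rewrite lerXn2r // ?nnegrE ?freq_ge0 ?insertion_only_cat ?i1 // freq_cat lerDl freq_ge0.
Qed.

Lemma F2_ge1 us : insertion_only us -> us != [::] -> 1 <= F2 R us.
Proof.
case: us => [//|u us] ius _; apply: le_trans (F2_cat_le (us := [:: u]) ius).
rewrite F2E (bigD1 u.1) //= ler_wpDr ?sumr_ge0 // => [l _|]; first exact: sqr_ge0.
rewrite freqE big_cons eqxx big_nil addr0 expr_ge1 ?ler0z //.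
  by case/andP: ius => u0 _; rewrite -[1]/(1%:~R) ler_int -gtz0_ge1.
by case/andP: ius => /ltW.
Qed.

Lemma F2_le_mass us : insertion_only us -> F2 R us <= (stream_mass us)%:R ^+ 2.
Proof.
move=> ius.
have -> : (stream_mass us)%:R = \sum_l freq us l.
  rewrite /stream_mass natr_sum (eq_bigr _ (fun l _ => freqE us l)).
  rewrite (exchange_big_dep xpredT) //= big_seq [RHS]big_seq; apply: eq_bigr => u uus.
  rewrite (big_pred1 u.1) => [|l]; last by rewrite eq_sym.
  rewrite -[u.2 in RHS]gez0_abs ?pmulrn //; apply: ltW.
  by move/allP: ius; exact.
rewrite F2E expr2 big_distrlr /=; apply: ler_sum => l _.
rewrite (bigD1 l) //= expr2 lerDl sumr_ge0 // => k _.
by rewrite mulr_ge0 ?freq_ge0.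
Qed.

Section Difference.
Variables us us' : seq (update n).
Hypothesis ius : insertion_only (us ++ us').

Let v l := freq us' l.
Let w l := freq us l + freq (us ++ us') l.

Lemma F2_diff_dot : \sum_l v l * w l = F2 R (us ++ us') - F2 R us.
Proof.
rewrite !F2E -sumrB; apply: eq_bigr => l _; rewrite /v /w freq_cat; ring.
Qed.

Lemma F2_diff_ge_sq : \sum_l v l ^+ 2 <= F2 R (us ++ us') - F2 R us.
Proof.
move: ius; rewrite insertion_only_cat => /andP[i1 i2].
rewrite -F2_diff_dot; apply: ler_sum => l _; rewrite /v /w freq_cat.
have a := freq_ge0 l i1; have b := freq_ge0 l i2.
have := mulr_ge0 b a; lra.
Qed.

Lemma F2_sum_le_sq : \sum_l w l ^+ 2 <= 4 * F2 R (us ++ us').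
Proof.
move: ius; rewrite insertion_only_cat => /andP[i1 i2].
rewrite F2E mulr_sumr; apply: ler_sum => l _; rewrite /w freq_cat.
have a := freq_ge0 l i1; have b := freq_ge0 l i2.
have := mulr_ge0 b a; have := sqr_ge0 (freq us' l); lra.
Qed.

Lemma diff_v_ge0 l : 0 <= v l.
Proof. by move: ius; rewrite insertion_only_cat => /andP[_ i2]; exact: freq_ge0. Qed.

Lemma diff_w_ge0 l : 0 <= w l.
Proof.
move: (ius); rewrite insertion_only_cat => /andP[i1 _].
by rewrite addr_ge0 ?freq_ge0.
Qed.

End Difference.
End Streams.

(** * Oblivious difference sketches *)

(* [sk_est q q'] estimates the growth of F2 between the two states. *)
Record sketch (R : realType) (n : nat) := Sketch {
  sk_seed : finType;
  sk_state : finType;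
  sk_init : sk_state;
  sk_upd : sk_seed -> sk_state -> update n -> sk_state;
  sk_est : sk_state -> sk_state -> R;
  sk_est_init : sk_est sk_init sk_init = 0
}.

Definition sk_run (R : realType) (n : nat) (K : sketch R n) (s : sk_seed K)
    (us : seq (update n)) : sk_state K :=
  foldl (sk_upd s) (sk_init K) us.

Definition sk_bad (R : realType) (n : nat) (K : sketch R n) (e2 : R)
    (us us' : seq (update n)) (s : sk_seed K) : bool :=
  e2 * (F2 R us' * (F2 R us' - F2 R us)) <
    (sk_est (sk_run s us) (sk_run s us') - (F2 R us' - F2 R us)) ^+ 2.

Definition sk_accurate (R : realType) (n : nat) (K : sketch R n)
    (valid : pred (seq (update n))) (e2 delta : R) : Prop :=
  forall us us' : seq (update n), valid us' -> prefix us us' ->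
    #|[pred s : sk_seed K | sk_bad e2 us us' s]|%:R <= delta * #|sk_seed K|%:R.

Section Counter.
Variable M : nat.

Definition enc (x : int) : 'I_(M.*2).+1 := inord `|x + M%:Z|.
Definition dec (k : 'I_(M.*2).+1) : int := k%:Z - M%:Z.

Lemma encK x : (`|x| <= M)%N -> dec (enc x) = x.
Proof. by move=> xM; rewrite /dec /enc inordK; lia. Qed.

End Counter.

Section AMS.
Variables (R : realType) (n d M T r : nat).
Variable z : 'rV[bool]_d -> 'I_n -> bool.

Definition ams_seed := {ffun 'I_T.+1 -> {ffun 'I_r -> 'rV[bool]_d}}.
Definition ams_state := {ffun 'I_T.+1 -> {ffun 'I_r -> 'I_(M.*2).+1}}.

Definition ams_init : ams_state := [ffun=> [ffun=> enc M 0]].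

Definition ams_upd (s : ams_seed) (q : ams_state) (u : update n) : ams_state :=
  [ffun g => [ffun i => enc M (dec (q g i) + (-1) ^+ (z (s g i) u.1) * u.2)]].

Definition ams_mean (q q' : {ffun 'I_r -> 'I_(M.*2).+1}) : R :=
  r%:R^-1 * \sum_i ((dec (q' i) - dec (q i)) * (dec (q i) + dec (q' i)))%:~R.

Definition ams_est (q q' : ams_state) : R := median (fun g => ams_mean (q g) (q' g)).

Lemma ams_est_init : ams_est ams_init ams_init = 0.
Proof.
rewrite /ams_est /median /ams_mean big1 ?mulr0 // => i _.
by rewrite subrr mul0r.
Qed.

Definition ams_sketch : sketch R n :=
  @Sketch R n ams_seed ams_state ams_init ams_upd ams_est ams_est_init.

Definition signed_sum (s : 'rV[bool]_d) (us : seq (update n)) : int :=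
  \sum_(u <- us) (-1) ^+ (z s u.1) * u.2.

Lemma signed_sum_le s us : (`|signed_sum s us| <= stream_mass us)%N.
Proof.
rewrite /signed_sum /stream_mass; elim: us => [|u us IH]; first by rewrite !big_nil.
rewrite !big_cons; set x := (_ * _); set y := \sum_(j <- us) _.
have : `|x|%N = `|u.2|%N by rewrite /x abszMsign.
by move: IH; rewrite -/y; set k := (\sum_(j <- us) _)%N; lia.
Qed.

Lemma ams_runE (s : ams_seed) us g i : (stream_mass us <= M)%N ->
  dec (sk_run (K := ams_sketch) s us g i) = signed_sum (s g i) us.
Proof.
rewrite /sk_run; elim/last_ind: us => [|us u IH] usM.
  by rewrite /= !ffunE encK // /signed_sum big_nil.
rewrite foldl_rcons /= !ffunE IH; last first.
  by apply: leq_trans usM; rewrite -cats1 stream_mass_cat leq_addr.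
have -> : signed_sum (s g i) us + (-1) ^+ (z (s g i) u.1) * u.2 = signed_sum (s g i) (rcons us u).
  by rewrite /signed_sum -cats1 big_cat big_seq1.
by rewrite encK // (leq_trans (signed_sum_le _ _)).
Qed.

Definition sgn (s : 'rV[bool]_d) (i : 'I_n) : R := (-1) ^+ (z s i).

Lemma signed_sum_lin s us : (signed_sum s us)%:~R = lin sgn (freq R us) s.
Proof.
rewrite /signed_sum /lin rmorph_sum /=.
under [RHS]eq_bigr => l _ do rewrite freqE mulr_suml.
rewrite (exchange_big_dep xpredT) //=; apply: eq_bigr => u _.
rewrite (big_pred1 u.1) => [|l]; last by rewrite eq_sym.
by rewrite rmorphM rmorph_sign mulrC.
Qed.

Hypothesis z2 : forall i j, \sum_s sgn s i * sgn s j = (#|'rV[bool]_d| * (i == j))%:R.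
Hypothesis z4 : forall i j k l, \sum_s sgn s i * sgn s j * sgn s k * sgn s l
  <= (#|'rV[bool]_d| * ((i == j) * (k == l) + (i == k) * (j == l) + (i == l) * (j == k)))%:R.

(* 192 = 16 * 3 * 4: failure probability of a group, fourth-moment constant,
   and |f + u|^2 <= 4 |f|^2 *)
Lemma ams_group_bad (e2 : R) (us us' : seq (update n)) :
  0 < e2 -> 192 <= r%:R * e2 -> insertion_only (us ++ us') ->
  (16 * #|[pred o : {ffun 'I_r -> 'rV[bool]_d} |
      (e2 * (F2 R (us ++ us') * (F2 R (us ++ us') - F2 R us)) <
      (r%:R^-1 * (\sum_i lin sgn (freq R us') (o i) *
          lin sgn (fun l => freq R us l + freq R (us ++ us') l) (o i))
        - (F2 R (us ++ us') - F2 R us)) ^+ 2)%R]|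
   <= #|{ffun 'I_r -> 'rV[bool]_d}|)%N.
Proof.
move=> e0 re ius; set F' := F2 R (us ++ us'); set D := F' - F2 R us.
set v := freq R us'; set w := fun l => _ + _.
have D0 : 0 <= D by rewrite subr_ge0; exact: F2_cat_le.
have F0 : 0 <= F' by exact: F2_ge0.
have r0 : 0 < r%:R :> R.
  by rewrite lt_neqAle ler0n andbT; apply: contraTneq re => <-; rewrite mul0r -ltNge; lra.
pose V : R := #|'rV[bool]_d|%:R.
have V0 : 0 < V by rewrite ltr0n; apply/card_gt0P; exists 0.
pose Y s := lin sgn v s * lin sgn w s - D.
have sumY : \sum_s Y s = 0.
  rewrite sumrB (sum_lin_mul z2) sumr_const -[D *+ _]mulr_natl.
  by rewrite (F2_diff_dot R us us') -/F' -/D -/V subrr.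
have sumY2 : \sum_s Y s ^+ 2 <= V * (12 * (F' * D)).
  apply: (@le_trans _ _ (\sum_s (lin sgn v s * lin sgn w s) ^+ 2)).
    have -> : \sum_s Y s ^+ 2 = \sum_s (lin sgn v s * lin sgn w s) ^+ 2
        - 2 * D * (\sum_s Y s) - V * D ^+ 2.
      transitivity (\sum_s ((lin sgn v s * lin sgn w s) ^+ 2 + (- (2 * D)) * Y s + - D ^+ 2)).
        by apply: eq_bigr => s _; rewrite /Y; ring.
      rewrite [LHS]big_split [X in X + _ = _]big_split /= -mulr_sumr sumr_const -[(- D ^+ 2) *+ _]mulr_natl -/V; ring.
    rewrite sumY mulr0 subr0 gerBl mulr_ge0 ?sqr_ge0 //; exact: ltW.
  apply: le_trans (sum_lin_mul_sq z4 (diff_v_ge0 R ius) (diff_w_ge0 R ius)) _.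
  apply: ler_wpM2l; first exact: ltW.
  have a := F2_diff_ge_sq R ius; have b := F2_sum_le_sq R ius.
  rewrite -/F' -/D -/v -/w in a b.
  have a0 : 0 <= \sum_l v l ^+ 2 by rewrite sumr_ge0 // => l _; exact: sqr_ge0.
  have b0 : 0 <= \sum_l w l ^+ 2 by rewrite sumr_ge0 // => l _; exact: sqr_ge0.
  have := ler_pM a0 b0 a b; lra.
rewrite -(ler_nat R) natrM.
have -> : #|{ffun 'I_r -> 'rV[bool]_d}|%:R = 16 * (16^-1 * #|{ffun 'I_r -> 'rV[bool]_d}|%:R) :> R by field.
apply: ler_wpM2l; first lra.
pose Z (o : {ffun 'I_r -> 'rV[bool]_d}) := r%:R^-1 * \sum_i Y (o i).
rewrite (eq_card (B := [pred o | e2 * (F' * D) < Z o ^+ 2])); last first.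
  move=> o; rewrite !inE /Z /Y sumrB sumr_const card_ord -[D *+ _]mulr_natl.
  by rewrite [r%:R^-1 * (_ - _)]mulrBr [r%:R^-1 * (r%:R * D)]mulrA mulVf ?mul1r // gt_eqF.
apply: chebyshev_card; [by rewrite !mulr_ge0 // ltW|by lra|].
set O : R := #|{ffun 'I_r -> _}|%:R.
have O0 : 0 <= O by exact: ler0n.
have := second_moment_ffun r sumY; rewrite -/O -/V => SM.
rewrite -(ler_pM2r V0).
have -> : (\sum_o Z o ^+ 2) * V = r%:R^-1 * O * \sum_s Y s ^+ 2.
  under eq_bigr => o _ do rewrite exprMn.
  by rewrite -mulr_sumr -mulrA SM; field; rewrite gt_eqF.
apply: le_trans (ler_wpM2l _ sumY2) _; first by rewrite mulr_ge0 // invr_ge0 ltW.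
have -> : r%:R^-1 * O * (V * (12 * (F' * D))) =
   (r%:R^-1 * (V * O * (F' * D) / 16)) * 192 by field; rewrite gt_eqF.
have -> : 16^-1 * (e2 * (F' * D)) * O * V = (r%:R^-1 * (V * O * (F' * D) / 16)) * (r%:R * e2).
  by field; rewrite gt_eqF.
apply: ler_wpM2l => //; rewrite mulr_ge0 ?invr_ge0 ?(ltW r0) //.
by rewrite !mulr_ge0 // ?(ltW V0) //; lra.
Qed.

Lemma ams_accurate (e2 : R) (valid : pred (seq (update n))) :
  0 < e2 -> 192 <= r%:R * e2 ->
  (forall us, valid us -> insertion_only us /\ (stream_mass us <= M)%N) ->
  sk_accurate ams_sketch valid e2 (2 ^+ T.+1)^-1.
Proof.
move=> e0 re valP us us' /valP[ius usM] /prefixP[us2 eus'].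
rewrite {us'}eus' in ius usM *.
have usM1 : (stream_mass us <= M)%N.
  by apply: leq_trans usM; rewrite stream_mass_cat leq_addr.
have := @card_majority_bad R _ T.+1 _ (ams_group_bad e0 re ius).
apply: le_trans; rewrite ler_nat; apply: subset_leq_card; apply/subsetP => s.
rewrite !inE /sk_bad /= /ams_est.
set F' := F2 R (us ++ us2); set D := F' - F2 R us; set E := e2 * (F' * D).
apply: contraLR; rewrite -ltnNge -leNgt => few.
apply: (median_majority (P := fun y => (y - D) ^+ 2 <= E)) => [a b c Pa Pc /andP[ab bc]|].
  have [bD|bD] := leP b D.
    apply: le_trans Pa; rewrite -(sqrrN (b - D)) -(sqrrN (a - D)) lerXn2r ?nnegrE; lra.
  by apply: le_trans Pc; rewrite lerXn2r ?nnegrE; lra.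
apply: leq_ltn_trans few; rewrite leq_mul2l /=; apply: subset_leq_card.
apply/subsetP => g; rewrite !inE -ltNge => /lt_le_trans; apply.
rewrite le_eqVlt; apply/orP; left; apply/eqP; congr ((_ * _ - _) ^+ 2).
apply: eq_bigr => i _.
rewrite (ams_runE s g i usM1) (ams_runE s g i usM) intrM intrB intrD !signed_sum_lin.
rewrite /lin; congr (_ * _); last first.
  by rewrite -big_split /=; apply: eq_bigr => l _; rewrite mulrDl.
by rewrite -sumrB; apply: eq_bigr => l _; rewrite freq_cat mulrDl addrAC subrr add0r.
Qed.

End AMS.

(** * One update of the switching rule *)

Section RealStep.
Variables (R : realType) (a b : R).
Hypotheses (b0 : 0 < b) (b1 : b < 1) (ab : a = b ^+ 2).

Let a0 : 0 < a. Proof. by rewrite ab exprn_gt0. Qed.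
Let a_le_b : a <= b.
Proof. by rewrite ab expr2 ger_pMr // ltW. Qed.

Lemma sqr_le_norm (x y : R) : 0 <= y -> x ^+ 2 <= y ^+ 2 -> - y <= x <= y.
Proof. by move=> y0 H; rewrite -ler_norml -ler_sqr ?nnegrE // real_normK ?num_real. Qed.

(* A weak copy is accurate while the growth [D] is at most [4 b P], and past
   that point cannot hide it. *)
Lemma weak_dichotomy (P D d : R) : 0 <= P -> 0 <= D ->
  (d - D) ^+ 2 <= a * b / (20 * 32 ^+ 2) * ((P + D) * D) ->
  (D <= 4 * b * P /\ D - a / 32 * P <= d <= D + a / 32 * P) \/
  (4 * b * P < D /\ 3 * b * P < d).
Proof.
move: (b0) (b1) (a0) (a_le_b) => hb0 hb1 ha0 hab.
move=> P0 D0 H; have [DP|PD] := leP D (4 * b * P); [left|right]; split=> //.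
  have : (d - D) ^+ 2 <= (a / 32 * P) ^+ 2.
    apply: le_trans H _.
    have PD : (P + D) * D <= (5 * P) * (4 * b * P).
      have bP : b * P <= P by rewrite -[leRHS]mul1r ler_wpM2r // ltW.
      by apply: ler_pM => //; lra.
    have -> : (a / 32 * P) ^+ 2 = a * b / (20 * 32 ^+ 2) * ((5 * P) * (4 * b * P)).
      by rewrite ab; field.
    by apply: ler_wpM2l PD; rewrite divr_ge0 ?mulr_ge0 ?exprn_ge0 ?(ltW a0) ?(ltW b0).
  move/sqr_le_norm; rewrite mulr_ge0 ?divr_ge0 ?(ltW a0) // => /(_ isT)/andP[]; lra.
rewrite ltNge; apply/negP => dP.
have Dp : 0 < D by apply: le_lt_trans PD; rewrite !mulr_ge0 // ltW.
have s1 : (D / 4) ^+ 2 <= (d - D) ^+ 2.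
  by rewrite -(sqrrN (d - D)) lerXn2r ?nnegrE; lra.
have s2 : a * b * (P * D) <= D * D.
  have : b * P * D <= D * D by apply: ler_wpM2r; lra.
  have : a * (b * P * D) <= 1 * (b * P * D).
    by apply: ler_wpM2r; [rewrite !mulr_ge0 // ltW | lra].
  lra.
have s3 : a * b * (D * D) <= D * D.
  have : a * b <= 1 by apply: mulr_ile1; rewrite ?ltW //; lra.
  by move=> ab1; rewrite ger_pMl // mulr_gt0.
have s4 : 0 < D * D by rewrite mulr_gt0.
lra.
Qed.

Record estimate_inv (P F V w : R) : Prop := EstimateInv {
  inv_P : 1 <= P;
  inv_PF : P <= F;
  inv_V : (1 - a / 32) * P <= V <= (1 + a / 32) * P;
  inv_w : V <= w <= (1 + b) * V;
  inv_wF : (1 - a / 2) * F <= w <= (1 + a / 8) * F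
}.

Lemma inv_fresh (F S : R) : 1 <= F ->
  (S - F) ^+ 2 <= (a / 32) ^+ 2 * (F * F) -> estimate_inv F F S S /\ 1 / 2 <= S.
Proof.
move: (b0) (b1) (a0) (a_le_b) => hb0 hb1 ha0 hab.
move=> F1; rewrite -[F * F]expr2 -exprMn => /sqr_le_norm.
rewrite mulr_ge0 ?divr_ge0 ?(ltW a0) //; last by lra.
move=> /(_ isT)/andP[lo hi].
have aF : 0 <= a * F by rewrite mulr_ge0 ?(ltW a0) //; lra.
have aF1 : a * F <= F by rewrite ger_pMl; lra.
split; last lra.
have bS : 0 <= b * S by rewrite mulr_ge0 ?(ltW b0) //; lra.
by split=> //; lra.
Qed.

Section Step.
Variables P F V w F' d S : R.
Hypotheses (inv : estimate_inv P F V w) (FF' : F <= F').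
Hypothesis weakOK : (d - (F' - P)) ^+ 2 <= a * b / (20 * 32 ^+ 2) * (F' * (F' - P)).
Hypothesis strongOK : (S - F') ^+ 2 <= (a / 32) ^+ 2 * (F' * F').

Let P1 : 1 <= P. Proof. exact: inv_P inv. Qed.
Let PF : P <= F. Proof. exact: inv_PF inv. Qed.
Let PF' : P <= F'. Proof. exact: le_trans PF FF'. Qed.
Let F'0 : 0 <= F'. Proof. by apply: le_trans PF'; apply: le_trans P1. Qed.
Let aP : 0 < a * P. Proof. by rewrite mulr_gt0 //; apply: lt_le_trans P1. Qed.
Let aP1 : a * P <= P. Proof. by rewrite ger_pMl ?(le_trans a_le_b) ?(lt_le_trans ltr01) // ltW. Qed.
Let aPbP : a * P <= b * P. Proof. by apply: ler_wpM2r => //; apply: le_trans P1. Qed.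

Let dich : (F' - P <= 4 * b * P /\
     F' - P - a / 32 * P <= d <= F' - P + a / 32 * P) \/
  (4 * b * P < F' - P /\ 3 * b * P < d).
Proof. by apply: weak_dichotomy; rewrite ?subr_ge0 ?[P + _]addrC ?subrK // (le_trans ler01). Qed.

Lemma step_keep : V + d <= (1 + a / 4) * w -> estimate_inv P F' V w.
Proof.
move: (b0) (b1) (a0) (a_le_b) (P1) (PF) (PF') (F'0) (aP) (aP1) (aPbP) => hb0 hb1 ha0 hab hP1 hPF hPF' hF'0 haP haP1 haPbP.
move=> keep; case: inv => _ _ /andP[V1 V2] /andP[w1 w2] /andP[w3 w4].
split=> //; rewrite ?V1 ?V2 ?w1 ?w2 //.
have -> : w <= (1 + a / 8) * F'.
  apply: le_trans w4 _; apply: ler_wpM2l => //; lra.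
rewrite andbT; case: dich => [[_ /andP[d1 d2]]|[_ d1]].
  have aPF' : a * P <= a * F' by apply: ler_wpM2l => //; lra.
  have a2F' : 0 <= a * a * F' by rewrite !mulr_ge0 //; lra.
  have k : (1 - a / 16) * F' <= (1 + a / 4) * w by lra.
  rewrite -(@ler_pM2l _ (1 + a / 4)); lra.
exfalso.
have V0 : 0 <= V by lra.
have : (1 + a / 4) * w <= (1 + a / 4) * ((1 + b) * V) by apply: ler_wpM2l => //; lra.
have : a * V <= b * V by apply: ler_wpM2r.
have : a * b * V <= b * V by rewrite ler_wpM2r // ger_pMl; lra.
have : b * V <= b * ((1 + a / 32) * P) by apply: ler_wpM2l => //; lra.
have : b * (a * P) <= b * P by apply: ler_wpM2l => //; lra.
have bP : 0 < b * P by rewrite mulr_gt0 //; lra.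
lra.
Qed.

Lemma step_refine : (1 + a / 4) * w < V + d -> V + d <= (1 + b) * V ->
  estimate_inv P F' V (V + d) /\ (1 + a / 8) * w <= V + d.
Proof.
move: (b0) (b1) (a0) (a_le_b) (P1) (PF) (PF') (F'0) (aP) (aP1) (aPbP) => hb0 hb1 ha0 hab hP1 hPF hPF' hF'0 haP haP1 haPbP.
move=> change small; case: inv => _ _ /andP[V1 V2] /andP[w1 w2] /andP[w3 w4].
have V0 : 0 <= V by lra.
have aw : 0 <= a * w by rewrite mulr_ge0; lra.
have bP : 0 < b * P by rewrite mulr_gt0 //; lra.
split; last lra.
case: dich => [[_ /andP[d1 d2]]|[_ d1]].
  have aPF' : a * P <= a * F' by apply: ler_wpM2l => //; lra.
  by split=> //; lra.
exfalso.
have : b * V <= b * ((1 + a / 32) * P) by apply: ler_wpM2l => //; lra.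
have : b * (a * P) <= b * P by apply: ler_wpM2l => //; lra.
lra.
Qed.

Lemma step_switch : (1 + a / 4) * w < V + d -> (1 + b) * V < V + d ->
  [/\ estimate_inv F' F' S S, (1 + a / 8) * w <= S & (1 + b / 2) * V <= S].
Proof.
move: (b0) (b1) (a0) (a_le_b) (P1) (PF) (PF') (F'0) (aP) (aP1) (aPbP) => hb0 hb1 ha0 hab hP1 hPF hPF' hF'0 haP haP1 haPbP.
move=> change large; case: inv => _ _ /andP[V1 V2] /andP[w1 w2] /andP[w3 w4].
have [|fresh _] := @inv_fresh F' S _ strongOK; first by lra.
have /andP[S1 _] := inv_V fresh.
have V0 : 0 <= V by lra.
have [na nb] := (ltW a0, ltW b0); have w0 := le_trans V0 w1.
have na1 : a <= 1 by exact: le_trans a_le_b (ltW b1).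
have aV : 0 <= a * V by rewrite !mulr_ge0.
have bV : 0 <= b * V by rewrite !mulr_ge0.
have aVbV : a * V <= b * V by apply: ler_wpM2r.
have aw : 0 <= a * w by rewrite !mulr_ge0.
have aVw : a * V <= a * w by apply: ler_wpM2l.
have a1 : 0 <= 1 - a / 32 by lra.
case: dich => [[_ /andP[d1 d2]]|[d0 d1]].
  have aPV : a * P <= 32 / 31 * (a * V).
    suff : a * (31 / 32 * P) <= a * V by lra.
    by apply: ler_wpM2l => //; lra.
  have G1 : (1 + a / 4 - a / 15) * w <= F' by lra.
  have G2 : (1 + b - a / 15) * V <= F' by lra.
  have H1 := ler_wpM2l a1 G1; have H2 := ler_wpM2l a1 G2.
  have aaw : a * (a * w) <= a * w by rewrite -[leRHS]mul1r ler_wpM2r.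
  have abV : a * (b * V) <= a * V by rewrite ler_wpM2l // -[leRHS]mul1r ler_wpM2r // ltW.
  have aaV : 0 <= a * (a * V) by rewrite !mulr_ge0.
  by split=> //; lra.
have bP : 0 < b * P by rewrite mulr_gt0 //; lra.
have PV : (1 - a / 32) * V <= P.
  have : (1 - a / 32) * V <= (1 - a / 32) * ((1 + a / 32) * P) by apply: ler_wpM2l.
  have : 0 <= a * (a * P) by rewrite !mulr_ge0 // (le_trans ler01 P1).
  lra.
have G : (1 + 4 * b) * ((1 - a / 32) * V) <= F'.
  have : (1 + 4 * b) * ((1 - a / 32) * V) <= (1 + 4 * b) * P by apply: ler_wpM2l => //; lra.
  lra.
have H := ler_wpM2l a1 G.
have abV : a * (b * V) <= b * V by rewrite -[leRHS]mul1r ler_wpM2r.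
have aaV : 0 <= a * (a * V) by rewrite !mulr_ge0.
have aabV : 0 <= a * (a * (b * V)) by rewrite !mulr_ge0.
have big : (1 + 2 * b) * V <= S by lra.
split=> //; last lra.
have : (1 + a / 8) * w <= (1 + a / 8) * ((1 + b) * V) by apply: ler_wpM2l => //; lra.
lra.
Qed.

End Step.
End RealStep.

(** * The interaction with unbounded memory *)

(* [g_pre] is the stream at the last strong estimate [g_V], [g_w] the current
   output, [g_e] and [g_c] the numbers of used strong and weak copies. *)
Record ghost (R : realType) (n : nat) := Ghost {
  g_us : seq (update n);
  g_zs : seq R;
  g_pre : seq (update n);
  g_e : nat;
  g_c : nat;
  g_V : R;
  g_w : R
}.

Section Ghost.
Variables (R : realType) (n : nat) (K1 K2 : sketch R n) (L1 L2 : nat) (a b : R).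
Variable adv : adversary R n.

Definition copies : finType :=
  ({ffun 'I_L1.+1 -> sk_seed K1} * {ffun 'I_L2.+1 -> sk_seed K2})%type.

Implicit Types (o : copies) (G : ghost R n) (us : seq (update n)).

Definition strong_val o (e : nat) us : R :=
  sk_est (sk_init K1) (sk_run (o.1 (inord e)) us).

Definition weak_val o (c : nat) pre us : R :=
  sk_est (sk_run (o.2 (inord c)) pre) (sk_run (o.2 (inord c)) us).

Definition ghost_us G := rcons (g_us G) (adv (g_us G) (g_zs G)).

Definition ghost_next o G : ghost R n :=
  let us := ghost_us G in
  let est := g_V G + weak_val o (g_c G) (g_pre G) us in
  if est <= (1 + a / 4) * g_w G then
    Ghost us (rcons (g_zs G) (g_w G)) (g_pre G) (g_e G) (g_c G) (g_V G) (g_w G)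
  else if est <= (1 + b) * g_V G then
    Ghost us (rcons (g_zs G) est) (g_pre G) (g_e G) (g_c G).+1 (g_V G) est
  else
    let S := strong_val o (g_e G) us in
    Ghost us (rcons (g_zs G) S) us (g_e G).+1 (g_c G).+1 S S.

Definition ghost_run o (j : nat) : ghost R n :=
  iter j (ghost_next o) (Ghost [::] [::] [::] 0 0 0 0).

Lemma ghost_next_us o G : g_us (ghost_next o G) = ghost_us G.
Proof. by rewrite /ghost_next; case: ifP => // _; case: ifP. Qed.

Lemma ghost_next_zs o G :
  g_zs (ghost_next o G) = rcons (g_zs G) (g_w (ghost_next o G)).
Proof. by rewrite /ghost_next; case: ifP => // _; case: ifP. Qed.

Lemma ghost_next_c o G : (g_c G <= g_c (ghost_next o G))%N.
Proof. by rewrite /ghost_next; case: ifP => // _; case: ifP => //= _. Qed.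

Lemma ghost_next_e o G : (g_e G <= g_e (ghost_next o G))%N.
Proof. by rewrite /ghost_next; case: ifP => // _; case: ifP => //= _. Qed.

Lemma ghost_size_us o j : size (g_us (ghost_run o j)) = j.
Proof. by elim: j => //= j IH; rewrite ghost_next_us /ghost_us size_rcons IH. Qed.

Lemma ghost_pre o j : prefix (g_pre (ghost_run o j)) (g_us (ghost_run o j)).
Proof.
elim: j => //= j /prefixP[t E]; rewrite /ghost_next /ghost_us.
case: ifP => _ /=; first by rewrite E rcons_cat prefix_prefix.
case: ifP => _ /=; last exact: prefix_refl.
by rewrite E rcons_cat prefix_prefix.
Qed.

(* While a weak copy is current, every step that does not use it up keeps
   the output, whatever its seed. *)
Lemma weak_agree o o' (c : 'I_L2.+1) j :
  o.1 = o'.1 -> (forall k, k != c -> o.2 k = o'.2 k) ->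
  (g_c (ghost_run o j) <= c)%N -> (g_c (ghost_run o' j) <= c)%N ->
  ghost_run o j = ghost_run o' j.
Proof.
move=> E1 E2; elim: j => //= j IH C C'.
have G := IH (leq_trans (ghost_next_c _ _) C) (leq_trans (ghost_next_c _ _) C').
rewrite -G in C' *; set H := ghost_run o j in C C' *.
have [Hc|Hc] := ltnP (g_c H) c.
  have cN : (inord (g_c H) : 'I_L2.+1) != c.
    by rewrite -val_eqE /= inordK ?(ltn_eqF Hc) // (leq_trans Hc) // ltnW.
  by rewrite /ghost_next /weak_val /strong_val E1 (E2 _ cN).
move: C C'; rewrite /ghost_next; case: ifP => _ /=; last first.
  by case: ifP => _ /= C; have := leq_trans C Hc; rewrite ltnn.
case: ifP => _ //=; case: ifP => _ //= _ C; have := leq_trans C Hc; by rewrite ltnn.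
Qed.

Lemma strong_agree o o' (e : 'I_L1.+1) j :
  o.2 = o'.2 -> (forall k, k != e -> o.1 k = o'.1 k) ->
  (g_e (ghost_run o j) <= e)%N -> (g_e (ghost_run o' j) <= e)%N ->
  ghost_run o j = ghost_run o' j.
Proof.
move=> E2 E1; elim: j => //= j IH C C'.
have G := IH (leq_trans (ghost_next_e _ _) C) (leq_trans (ghost_next_e _ _) C').
rewrite -G in C' *; set H := ghost_run o j in C C' *.
have [He|He] := ltnP (g_e H) e.
  have eN : (inord (g_e H) : 'I_L1.+1) != e.
    by rewrite -val_eqE /= inordK ?(ltn_eqF He) // (leq_trans He) // ltnW.
  by rewrite /ghost_next /weak_val /strong_val E2 (E1 _ eN).
move: C C'; rewrite /ghost_next /weak_val E2.
case: ifP => _ //=; case: ifP => _ //= C; have := leq_trans C He; by rewrite ltnn.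
Qed.

Variables (es ew : R) (m : nat).

Definition bad_weak (c : 'I_L2.+1) (j : nat) o : bool :=
  let G := ghost_run o j in
  (g_c G == c) && sk_bad ew (g_pre G) (ghost_us G) (o.2 c).

Definition bad_strong (e : 'I_L1.+1) (j : nat) o : bool :=
  let G := ghost_run o j in
  (g_e G == e) && sk_bad es [::] (ghost_us G) (o.1 e).

Definition all_accurate o : bool :=
  [forall j : 'I_m, [forall c, ~~ bad_weak c j o] && [forall e, ~~ bad_strong e j o]].

Variables (valid : pred (seq (update n))) (delta : R).
Hypothesis delta0 : 0 <= delta.
Hypothesis acc1 : sk_accurate K1 valid es delta.
Hypothesis acc2 : sk_accurate K2 valid ew delta.
Hypothesis validP : forall o j, (j <= m)%N -> valid (g_us (ghost_run o j)).

Lemma card_bad_weak c (j : 'I_m) : #|bad_weak c j|%:R <= delta * #|copies|%:R.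
Proof.
pose l := snd_lens {ffun 'I_L1.+1 -> sk_seed K1} (ffun_lens (sk_seed K2) c).
pose Bad G := sk_bad (K := K2) ew (g_pre G) (ghost_us G).
apply: (@card_resample R copies (sk_seed K2) l (ghost R n) (fun o => g_c (ghost_run o j) == c)
  (fun o => ghost_run o j) Bad) => // [o s /eqP Ec /eqP Ec'|o _].
  apply: (weak_agree (c := c)); rewrite ?Ec ?Ec' // => k kc /=.
  by rewrite ffunE (negbTE kc).
apply: acc2; first by have := validP o (ltn_ord j); rewrite /= ghost_next_us.
by have /prefixP[t E] := ghost_pre o j; rewrite /ghost_us E rcons_cat prefix_prefix.
Qed.

Lemma card_bad_strong e (j : 'I_m) : #|bad_strong e j|%:R <= delta * #|copies|%:R.
Proof.
pose l := fst_lens {ffun 'I_L2.+1 -> sk_seed K2} (ffun_lens (sk_seed K1) e).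
pose Bad G := sk_bad (K := K1) es [::] (ghost_us G).
apply: (@card_resample R copies (sk_seed K1) l (ghost R n) (fun o => g_e (ghost_run o j) == e)
  (fun o => ghost_run o j) Bad) => // [o s /eqP Ee /eqP Ee'|o _].
  apply: (strong_agree (e := e)); rewrite ?Ee ?Ee' // => k ke /=.
  by rewrite ffunE (negbTE ke).
apply: acc1; first by have := validP o (ltn_ord j); rewrite /= ghost_next_us.
exact: prefix0s.
Qed.

Lemma card_not_all_accurate :
  #|[pred o | ~~ all_accurate o]|%:R <=
    (m * (L1.+1 + L2.+1))%:R * delta * #|copies|%:R.
Proof.
have sub : (#|[pred o | ~~ all_accurate o]| <=
    \sum_(j < m) (\sum_(c < L2.+1) #|bad_weak c j| + \sum_(e < L1.+1) #|bad_strong e j|))%N.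
  rewrite -sum1_card.
  have card_nat (P : pred copies) : #|P| = (\sum_o P o)%N.
    by rewrite -sum1_card big_mkcond; apply: eq_bigr => o _; rewrite unfold_in; case: (P o).
  under [leqRHS]eq_bigr => j _.
    under eq_bigr => c _ do rewrite card_nat.
    under [X in (_ + X)%N]eq_bigr => e _ do rewrite card_nat.
    rewrite exchange_big [X in (_ + X)%N]exchange_big -big_split /=.
    over.
  rewrite exchange_big big_mkcond /=; apply: leq_sum => o _.
  rewrite inE; case: ifP => // /forallPn[j].
  rewrite (bigD1 j) //= negb_and => /orP[/forallPn[c]|/forallPn[e]].
    by rewrite negbK (bigD1 c) //= => ->.
  by rewrite negbK [X in (_ + X + _)%N](bigD1 e) //= => ->; rewrite addnCA.
apply: (@le_trans _ _ (\sum_(j < m) (\sum_(c < L2.+1) #|bad_weak c j| + \sum_(e < L1.+1) #|bad_strong e j|))%N%:R).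
  by rewrite ler_nat.
rewrite natr_sum.
apply: (@le_trans _ _ (\sum_(j < m) (\sum_(c < L2.+1) (delta * #|copies|%:R) + \sum_(e < L1.+1) (delta * #|copies|%:R)))).
  apply: ler_sum => j _; rewrite natrD !natr_sum; apply: lerD; apply: ler_sum => k _.
    exact: card_bad_weak.
  exact: card_bad_strong.
rewrite !sumr_const !card_ord -mulrnDr -mulrnA -[leLHS]mulr_natl mulrA.
by rewrite [(_ * m)%N]mulnC [(L2.+1 + _)%N]addnC.
Qed.

End Ghost.

Lemma geometric_step (R : realType) (x w w' : R) k : 0 < x -> (0 < k)%N ->
  1 / 2 * (1 + x) ^+ k.-1 <= w -> (1 + x) * w <= w' -> 1 / 2 * (1 + x) ^+ k <= w'.
Proof.
move=> x0 k0 H1 H2; rewrite -(prednK k0) exprS mulrCA; apply: le_trans H2.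
by apply: ler_wpM2l => //; lra.
Qed.

Section GhostCorrect.
Variables (R : realType) (n : nat) (K1 K2 : sketch R n) (L1 L2 : nat) (a b : R).
Variables (adv : adversary R n) (m : nat) (Fm : R).
Hypotheses (b0 : 0 < b) (b1 : b < 1) (ab : a = b ^+ 2).
Hypothesis cap1 : 4 * Fm < (1 + b / 2) ^+ L1.
Hypothesis cap2 : 4 * Fm < (1 + a / 8) ^+ L2.

Let es := (a / 32) ^+ 2.
Let ew := a * b / (20 * 32 ^+ 2).

Variable o : copies K1 K2 L1 L2.
Let run := ghost_run a b adv o.

Hypothesis ins : forall j, (j <= m)%N -> insertion_only (g_us (run j)).
Hypothesis Fbound : forall j, (j <= m)%N -> F2 R (g_us (run j)) <= Fm.
Hypothesis acc : all_accurate a b adv es ew m o.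

Record ghost_inv (G : ghost R n) : Prop := GhostInv {
  gi_est : estimate_inv a b (F2 R (g_pre G)) (F2 R (g_us G)) (g_V G) (g_w G);
  gi_c0 : (0 < g_c G)%N;
  gi_e0 : (0 < g_e G)%N;
  gi_c : 1 / 2 * (1 + a / 8) ^+ (g_c G).-1 <= g_w G;
  gi_e : 1 / 2 * (1 + b / 2) ^+ (g_e G).-1 <= g_V G
}.

Lemma ghost_inv_caps j : (j <= m)%N -> ghost_inv (run j) ->
  (g_c (run j) <= L2)%N /\ (g_e (run j) <= L1)%N.
Proof.
move=> jm [[P1 PF _ /andP[Vw _] /andP[_ wF]] c0 e0 Hc He].
have FM := Fbound jm.
have a0 : 0 < a by rewrite ab exprn_gt0.
have a1 : a < 1 by rewrite ab expr_lt1 // ltW.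
have w2 : g_w (run j) <= 2 * Fm.
  apply: le_trans wF _; apply: ler_pM => //; last lra; last lra.
  by move: a0 a1 => ? ?; lra.
have expr_lt (x : R) k l : 0 < x -> 1 / 2 * (1 + x) ^+ k <= 2 * Fm ->
    4 * Fm < (1 + x) ^+ l -> (k < l)%N.
  move=> x0 H1 H2; have : (1 + x) ^+ k < (1 + x) ^+ l by lra.
  by rewrite ltr_eXn2l //; lra.
split.
  by rewrite -(prednK c0); apply: expr_lt cap2; [rewrite divr_gt0 | exact: le_trans w2].
rewrite -(prednK e0); apply: expr_lt cap1; first by rewrite divr_gt0.
exact: le_trans (le_trans He Vw) w2.
Qed.

Lemma weak_ok j : (j < m)%N -> (g_c (run j) <= L2)%N ->
  let D := F2 R (g_us (run j.+1)) - F2 R (g_pre (run j)) in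
  (weak_val o (g_c (run j)) (g_pre (run j)) (g_us (run j.+1)) - D) ^+ 2 <=
     ew * (F2 R (g_us (run j.+1)) * D).
Proof.
move=> jm cL; move/forallP/(_ (Ordinal jm))/andP: acc => [/forallP/(_ (inord (g_c (run j))))].
by rewrite /bad_weak inordK // eqxx /= /sk_bad -leNgt ghost_next_us.
Qed.

Lemma strong_ok j : (j < m)%N -> (g_e (run j) <= L1)%N ->
  let F := F2 R (g_us (run j.+1)) in
  (strong_val o (g_e (run j)) (g_us (run j.+1)) - F) ^+ 2 <= es * (F * F).
Proof.
move=> jm eL; move/forallP/(_ (Ordinal jm))/andP: acc => [_ /forallP/(_ (inord (g_e (run j))))].
by rewrite /bad_strong inordK // eqxx /= /sk_bad -leNgt F2_nil subr0 ghost_next_us.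
Qed.

Lemma ghost_inv_run j : (j < m)%N -> ghost_inv (run j.+1).
Proof.
have a0 : 0 < a by rewrite ab exprn_gt0.
have a1 : a < 1 by rewrite ab expr_lt1 // ltW.
elim: j => [|j IH] jm.
  have W := @weak_ok 0 jm isT; have S := @strong_ok 0 jm isT.
  have F1 : 1 <= F2 R (g_us (run 1)).
    apply: F2_ge1; first exact: ins.
    by rewrite -size_eq0 ghost_size_us.
  move: W S F1; rewrite /= ghost_next_us F2_nil subr0 /ghost_next /=.
  set us := ghost_us _ _; set d := weak_val _ _ _ _; set s := strong_val _ _ _.
  move=> W S F1.
  have W0 : (d - F2 R us) ^+ 2 <= a * b / (20 * 32 ^+ 2) * ((0 + F2 R us) * F2 R us) by rewrite add0r.
  have [[]|[_]] := weak_dichotomy b0 b1 ab (lexx 0) (le_trans ler01 F1) W0.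
    by rewrite mulr0; lra.
  rewrite mulr0 => d0; rewrite !mulr0 add0r leNgt d0 /=.
  have [fresh s2] := inv_fresh b0 b1 ab F1 S.
  by split=> //=; rewrite expr0 mulr1.
have inv := IH (ltnW jm).
have [cL eL] := ghost_inv_caps (ltnW jm) inv.
have W := weak_ok jm cL; have S := strong_ok jm eL.
have FF : F2 R (g_us (run j.+1)) <= F2 R (g_us (run j.+2)).
  have := ins jm; rewrite /= [g_us (ghost_next a b adv o _)]ghost_next_us /ghost_us -cats1.
  exact: F2_cat_le.
case: inv => inv c0 e0 Hc He.
move: W S FF; rewrite -[run j.+2]/(ghost_next a b adv o (run j.+1)) ghost_next_us.
set G := run j.+1 in inv c0 e0 Hc He cL eL *.
rewrite /ghost_next; set us := ghost_us _ _; set d := weak_val _ _ _ _; set s := strong_val _ _ _.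
move=> W S FF.
have K := step_keep b0 b1 ab inv FF W.
have Rf := step_refine b0 b1 ab inv FF W.
have Sw := step_switch b0 b1 ab inv FF W S.
case: ifP => [|/negbT]; first by move=> /K ?; split.
rewrite -ltNge => change; case: ifP => [small|/negbT].
  have [inv' w'] := Rf change small.
  by split=> //=; apply: geometric_step w' => //; rewrite divr_gt0.
rewrite -ltNge => large; have [inv' w' V'] := Sw change large.
by split=> //=; [apply: geometric_step w' => //; rewrite divr_gt0 | apply: geometric_step V' => //; rewrite divr_gt0].
Qed.

Lemma ghost_caps j : (j <= m)%N -> (g_c (run j) <= L2)%N /\ (g_e (run j) <= L1)%N.
Proof. by case: j => // j jm; apply: ghost_inv_caps => //; exact: ghost_inv_run. Qed.

Lemma ghost_accurate j : (j < m)%N ->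
  (1 - a) * F2 R (g_us (run j.+1)) <= g_w (run j.+1) <= (1 + a) * F2 R (g_us (run j.+1)).
Proof.
move=> /ghost_inv_run[[_ _ _ _ /andP[lo hi]] _ _ _ _].
have F0 := F2_ge0 R (g_us (run j.+1)).
have a0 : 0 < a by rewrite ab exprn_gt0.
by apply/andP; split; [apply: le_trans lo | apply: le_trans hi _]; apply: ler_wpM2r => //; lra.
Qed.

End GhostCorrect.

(** * Deterministic algorithms with a random seed *)

Section History.
Variables (R : realType) (n : nat) (adv : adversary R n).
Variables (us : nat -> seq (update n)) (zs : nat -> seq R) (y : nat -> R).
Hypothesis us0 : us 0 = [::].
Hypothesis usS : forall j, us j.+1 = rcons (us j) (adv (us j) (zs j)).
Hypothesis zs0 : zs 0 = [::].
Hypothesis zsS : forall j, zs j.+1 = rcons (zs j) (y j).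

Lemma history_zs j : zs j = mkseq y j.
Proof.
by elim: j => [|j IH]; rewrite ?zs0 // zsS IH /mkseq -addn1 iotaD map_cat cats1.
Qed.

Lemma history_take m j : (j <= m)%N -> take j (zs m) = zs j.
Proof. by move=> jm; rewrite !history_zs /mkseq -map_take take_iota (minn_idPl jm). Qed.

Lemma history_stream m j : (j <= m)%N -> adaptive_stream adv (zs m) j = us j.
Proof.
elim: j => [|j IH] jm /=; first by rewrite us0.
by rewrite IH ?history_take ?usS // ltnW.
Qed.

End History.

Lemma adaptive_stream_prefix (R : realType) (n : nat) (adv : adversary R n) z j m :
  (j <= m)%N -> prefix (adaptive_stream adv z j) (adaptive_stream adv z m).
Proof.
elim: m => [|m IH]; first by rewrite leqn0 => /eqP ->.
rewrite leq_eqVlt => /orP[/eqP -> |]; first exact: prefix_refl.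
by rewrite ltnS => /IH /prefixP[t E] /=; rewrite E rcons_cat prefix_prefix.
Qed.

Section Seeded.
Variables (R : realType) (n : nat) (Omega St : finType).
Variables (ini : Omega -> St) (nxt : St -> update n -> St) (out : St -> R).
Hypothesis Omega_gt0 : (0 < #|Omega|)%N.

Definition dirac (s : St) : St -> R := fun s' => (s' == s)%:R.

Lemma dirac_ge0 s s' : 0 <= dirac s s'.
Proof. exact: ler0n. Qed.

Lemma dirac_sum s : \sum_s' dirac s s' = 1.
Proof.
rewrite /dirac (bigD1 s) //= eqxx big1 ?addr0 // => s' /negbTE ->.
by [].
Qed.

Definition seed_mass (s : St) : R := #|[pred o | ini o == s]|%:R / #|Omega|%:R.

Lemma seed_mass_ge0 s : 0 <= seed_mass s.
Proof. by rewrite divr_ge0 // ler0n. Qed.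

Lemma sum_seed_mass (P : pred St) :
  \sum_(s | P s) seed_mass s = #|[pred o | P (ini o)]|%:R / #|Omega|%:R.
Proof.
rewrite /seed_mass -mulr_suml -natr_sum; congr (_%:R / _).
rewrite -sum1_card (partition_big ini P) //=.
apply: eq_bigr => s Ps; rewrite -sum1_card; apply: eq_bigl => o.
by rewrite !inE; case: eqP => [->|]; rewrite ?Ps // andbF.
Qed.

Lemma seed_mass_sum : \sum_s seed_mass s = 1.
Proof.
by rewrite sum_seed_mass (eq_card (B := Omega)) // divff // pnatr_eq0 -lt0n.
Qed.

Definition seeded_alg : stream_alg R n :=
  @StreamAlg R n St (FinDistr seed_mass_ge0 seed_mass_sum)
    (fun s u => FinDistr (dirac_ge0 (nxt s u)) (dirac_sum (nxt s u))) out.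

Variable adv : adversary R n.

Definition det_next (x : seq (update n) * seq R * St) :=
  let u := adv x.1.1 x.1.2 in
  (rcons x.1.1 u, rcons x.1.2 (out (nxt x.2 u)), nxt x.2 u).

Definition det_run (s : St) (j : nat) := iter j det_next ([::], [::], s).

Definition det_states (s : St) (m : nat) : m.-tuple St :=
  [tuple of mkseq (fun j => (det_run s j.+1).2) m].

Lemma det_stream s m j : (j <= m)%N ->
  adaptive_stream adv (det_run s m).1.2 j = (det_run s j).1.1.
Proof.
exact: (@history_stream R n adv (fun j => (det_run s j).1.1) (fun j => (det_run s j).1.2)
  (fun j => out (det_run s j.+1).2)).
Qed.

Lemma det_take s m j : (j <= m)%N -> take j (det_run s m).1.2 = (det_run s j).1.2.
Proof.
exact: (@history_take R (fun j => (det_run s j).1.2) (fun j => out (det_run s j.+1).2)).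
Qed.

Lemma det_outputs s m : outputs (A := seeded_alg) (det_states s m) = (det_run s m).1.2.
Proof.
rewrite (@history_zs R (fun j => (det_run s j).1.2) (fun j => out (det_run s j.+1).2)) //.
by rewrite /outputs /= /mkseq -map_comp.
Qed.

Lemma det_run_prob s m :
  run_prob (A := seeded_alg) adv s (det_states s m) = seed_mass s.
Proof.
rewrite /run_prob /= big1 ?mulr1 // => j _; rewrite det_outputs /adaptive_update.
have jm := ltnW (ltn_ord j).
rewrite det_stream // det_take // (tnth_nth s) nth_mkseq //=.
have -> : nth s (s :: mkseq (fun j => (det_run s j.+1).2) m) j = (det_run s j).2.
  by case: {jm} j => [[|j]] //= jm; rewrite nth_mkseq // ltnW.
by rewrite /dirac eqxx.
Qed.

Lemma seeded_success m alpha :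
  #|[pred o | run_accurate (A := seeded_alg) adv alpha (det_states (ini o) m)]|%:R / #|Omega|%:R
    <= success_prob m seeded_alg adv alpha.
Proof.
rewrite -(sum_seed_mass (fun s => run_accurate (A := seeded_alg) adv alpha (det_states s m))).
rewrite big_mkcond /success_prob; apply: ler_sum => s _.
have run_ge0 t : 0 <= run_prob (A := seeded_alg) (m := m) adv s t.
  by rewrite mulr_ge0 ?mass_ge0 // prodr_ge0 // => j _; exact: mass_ge0.
case: ifP => [ok|_]; last by rewrite sumr_ge0.
by rewrite (bigD1 (det_states s m)) //= det_run_prob lerDl sumr_ge0.
Qed.

End Seeded.

(** * The finite-state algorithm *)

Section Switching.
Variables (R : realType) (n : nat) (K1 K2 : sketch R n) (L1 L2 : nat) (a b : R).

Notation copies := (copies K1 K2 L1 L2).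
Notation Q1 := (sk_state K1).
Notation Q2 := (sk_state K2).

(* Seeds; running strong sketches, snapshots and running weak sketches; numbers
   of used copies; frozen sketches, of which the output is a function. *)
Definition sw_state : finType :=
  (copies * ({ffun 'I_L1.+1 -> Q1} * ({ffun 'I_L2.+1 -> Q2} * {ffun 'I_L2.+1 -> Q2}))
    * ('I_L1.+1 * 'I_L2.+1) * (Q1 * (Q2 * Q2)))%type.

Definition sw_out (st : sw_state) : R :=
  let: (_, (qV, (qa, qb))) := st in sk_est (sk_init K1) qV + sk_est qa qb.

Definition sw_init (o : copies) : sw_state :=
  (o, ([ffun=> sk_init K1], ([ffun=> sk_init K2], [ffun=> sk_init K2])), (ord0, ord0),
   (sk_init K1, (sk_init K2, sk_init K2))).

Definition sw_next (st : sw_state) (u : update n) : sw_state :=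
  let: (o, (q1, (qs, q2)), (e, c), (qV, (qa, qb))) := st in
  let q1' := [ffun k => sk_upd (o.1 k) (q1 k) u] in
  let q2' := [ffun k => sk_upd (o.2 k) (q2 k) u] in
  let V := sk_est (sk_init K1) qV in
  let w := V + sk_est qa qb in
  let est := V + sk_est (qs c) (q2' c) in
  if est <= (1 + a / 4) * w then (o, (q1', (qs, q2')), (e, c), (qV, (qa, qb)))
  else if est <= (1 + b) * V then
    (o, (q1', (qs, q2')), (e, inord c.+1), (qV, (qs c, q2' c)))
  else (o, (q1', (q2', q2')), (inord e.+1, inord c.+1),
        (q1' e, (sk_init K2, sk_init K2))).

Definition represents (o : copies) (G : ghost R n) (st : sw_state) : Prop :=
  exists qV qa qb,
    [/\ st = (o, ([ffun k => sk_run (o.1 k) (g_us G)],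
                  ([ffun k => sk_run (o.2 k) (g_pre G)], [ffun k => sk_run (o.2 k) (g_us G)])),
              (inord (g_e G), inord (g_c G)), (qV, (qa, qb))),
        g_V G = sk_est (sk_init K1) qV &
        g_w G = g_V G + sk_est qa qb].

Lemma represents_out o G st : represents o G st -> sw_out st = g_w G.
Proof. by move=> [qV [qa [qb [-> V w]]]]; rewrite w V. Qed.

Lemma represents_next adv o G st : represents o G st ->
  (g_c G <= L2)%N -> (g_e G <= L1)%N ->
  represents o (ghost_next a b adv o G) (sw_next st (adv (g_us G) (g_zs G))).
Proof.
move=> [qV [qa [qb [-> V w]]]] cL eL; rewrite /sw_next -V -w.
set u := adv _ _.
have r1 : [ffun k => sk_upd (o.1 k) ([ffun k => sk_run (o.1 k) (g_us G)] k) u]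
    = [ffun k => sk_run (o.1 k) (ghost_us adv G)] :> {ffun 'I_L1.+1 -> Q1}.
  by apply/ffunP => k; rewrite !ffunE /sk_run /ghost_us foldl_rcons.
have r2 : [ffun k => sk_upd (o.2 k) ([ffun k => sk_run (o.2 k) (g_us G)] k) u]
    = [ffun k => sk_run (o.2 k) (ghost_us adv G)] :> {ffun 'I_L2.+1 -> Q2}.
  by apply/ffunP => k; rewrite !ffunE /sk_run /ghost_us foldl_rcons.
rewrite r1 r2 /ghost_next /weak_val /strong_val !ffunE.
case: ifP => _; first by exists qV, qa, qb.
case: ifP => _; first by exists qV; eexists; eexists; split; rewrite ?inordK ?ltnS.
eexists; exists (sk_init K2), (sk_init K2); split; rewrite ?inordK ?ltnS //=.
by rewrite sk_est_init addr0.
Qed.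

Lemma represents_init o : represents o (Ghost [::] [::] [::] 0 0 0 0) (sw_init o).
Proof.
exists (sk_init K1), (sk_init K2), (sk_init K2); split; rewrite ?sk_est_init ?addr0 //=.
rewrite /sw_init; congr (_, (_, (_, _)), (_, _), _); try by apply/ffunP => k; rewrite !ffunE.
  by apply: val_inj; rewrite /= inordK.
by apply: val_inj; rewrite /= inordK.
Qed.

Hypothesis copies_gt0 : (0 < #|copies|)%N.

Definition switching_alg : stream_alg R n := seeded_alg sw_init sw_next sw_out copies_gt0.

Lemma det_run_ghost adv o m :
  (forall j, (j < m)%N -> (g_c (ghost_run a b adv o j) <= L2)%N /\
     (g_e (ghost_run a b adv o j) <= L1)%N) ->
  forall j, (j <= m)%N ->
  [/\ (det_run sw_next sw_out adv (sw_init o) j).1.1 = g_us (ghost_run a b adv o j),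
      (det_run sw_next sw_out adv (sw_init o) j).1.2 = g_zs (ghost_run a b adv o j) &
      represents o (ghost_run a b adv o j) (det_run sw_next sw_out adv (sw_init o) j).2].
Proof.
move=> caps; elim=> [|j IH] jm; first by split=> //; exact: represents_init.
have [Eus Ezs rep] := IH (ltnW jm); have [cL eL] := caps j jm.
have := represents_next adv rep cL eL.
rewrite -[det_run _ _ _ _ j.+1]/(det_next _ _ _ (det_run _ _ _ _ j)) /det_next Eus Ezs /= => rep'.
by split; rewrite ?ghost_next_us ?ghost_next_zs ?(represents_out rep').
Qed.

Lemma ghost_stream adv (o : copies) m j : (j <= m)%N ->
  adaptive_stream adv (g_zs (ghost_run a b adv o m)) j = g_us (ghost_run a b adv o j).
Proof.
exact: (@history_stream R n adv (fun j => g_us (ghost_run a b adv o j))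
  (fun j => g_zs (ghost_run a b adv o j)) (fun j => g_w (ghost_run a b adv o j.+1)) erefl
  (fun j => ghost_next_us _ _ _ _ _) erefl (fun j => ghost_next_zs _ _ _ _ _)).
Qed.

Section Robust.
Variables (m B : nat) (delta : R).
Hypotheses (m0 : (0 < m)%N) (b0 : 0 < b) (b1 : b < 1) (ab : a = b ^+ 2).
Hypothesis cap1 : 4 * ((m * B)%:R ^+ 2) < (1 + b / 2) ^+ L1.
Hypothesis cap2 : 4 * ((m * B)%:R ^+ 2) < (1 + a / 8) ^+ L2.

Definition valid_stream (us : seq (update n)) : bool :=
  [&& insertion_only us, values_bounded B us & (size us <= m)%N].

Lemma valid_stream_mass us : valid_stream us -> insertion_only us /\ (stream_mass us <= m * B)%N.
Proof.
move=> /and3P[i v s]; split=> //; apply: leq_trans (stream_mass_le v) _.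
by rewrite leq_mul2r s orbT.
Qed.

Hypothesis delta0 : 0 <= delta.
Hypothesis acc1 : sk_accurate K1 valid_stream ((a / 32) ^+ 2) delta.
Hypothesis acc2 : sk_accurate K2 valid_stream (a * b / (20 * 32 ^+ 2)) delta.
Hypothesis delta_small : (m * (L1.+1 + L2.+1))%:R * delta <= m%:R^-1.

Lemma switching_robust : robust_F2 m B a switching_alg.
Proof.
move=> adv advOK.
have valid_ghost (o : copies) j : (j <= m)%N -> valid_stream (g_us (ghost_run a b adv o j)).
  move=> jm; rewrite /valid_stream ghost_size_us jm andbT -(ghost_stream _ _ jm).
  have /andP[i v] := advOK (g_zs (ghost_run a b adv o m)).
  have /prefixP[t E] := adaptive_stream_prefix adv (g_zs (ghost_run a b adv o m)) jm.
  by move: i v; rewrite /insertion_only /values_bounded E !all_cat => /andP[-> _] /andP[-> _].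
apply: le_trans _ (seeded_success sw_init sw_next sw_out copies_gt0 adv m a).
have C0 : 0 < #|copies|%:R :> R by rewrite ltr0n.
rewrite ler_pdivlMr //.
have bad := card_not_all_accurate delta0 acc1 acc2 valid_ghost.
have good : (#|copies| <= #|[pred o : copies | ~~ all_accurate a b adv ((a / 32) ^+ 2) (a * b / (20 * 32 ^+ 2)) m o]| +
   #|[pred o : copies | run_accurate (A := switching_alg) adv a (det_states sw_next sw_out adv (sw_init o) m)]|)%N.
  rewrite -(cardC [pred o : copies | ~~ all_accurate a b adv ((a / 32) ^+ 2) (a * b / (20 * 32 ^+ 2)) m o]).
  rewrite leq_add2l; apply: subset_leq_card; apply/subsetP => o; rewrite !inE negbK => ok.
  have ins j : (j <= m)%N -> insertion_only (g_us (ghost_run a b adv o j)).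
    by move=> /(valid_ghost o)/valid_stream_mass[].
  have Fb j : (j <= m)%N -> F2 R (g_us (ghost_run a b adv o j)) <= (m * B)%:R ^+ 2.
    move=> /(valid_ghost o)/valid_stream_mass[i M]; apply: le_trans (F2_le_mass R i) _.
    by rewrite lerXn2r ?nnegrE ?ler0n // ler_nat.
  have caps := ghost_caps b0 b1 ab cap1 cap2 ins Fb ok.
  have run := det_run_ghost (fun j (jm : (j < m)%N) => caps j (ltnW jm)).
  apply/forallP => j; have jm := ltn_ord j.
  rewrite det_outputs det_stream // (tnth_nth (sw_init o)) nth_mkseq //.
  have [-> _ rep] := run j.+1 jm.
  rewrite /= (represents_out rep).
  exact: (ghost_accurate b0 b1 ab cap1 cap2 ins Fb ok jm).
have : #|copies|%:R <= (m * (L1.+1 + L2.+1))%:R * delta * #|copies|%:R +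
   #|[pred o : copies | run_accurate (A := switching_alg) adv a (det_states sw_next sw_out adv (sw_init o) m)]|%:R :> R.
  apply: (@le_trans _ _ (_ + _)%N%:R); first by rewrite ler_nat; exact: good.
  by rewrite natrD lerD2r.
have := ler_wpM2r (ltW C0) delta_small; lra.
Qed.

End Robust.

End Switching.

(** * Space *)

Lemma card_sw_state (R : realType) (n L1 L2 s1 q1 s2 q2 : nat) (K1 K2 : sketch R n) :
  (#|sk_seed K1| <= 2 ^ s1)%N -> (#|sk_state K1| <= 2 ^ q1)%N ->
  (#|sk_seed K2| <= 2 ^ s2)%N -> (#|sk_state K2| <= 2 ^ q2)%N ->
  (#|sw_state K1 K2 L1 L2| <=
    2 ^ ((s1 + q1) * L1.+2 + (s2 + q2.*2) * L2.+2 + L1.+1 + L2.+1))%N.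
Proof.
move=> S1 H1 S2 H2.
have pow (W : finType) s L : (#|W| <= 2 ^ s -> #|{ffun 'I_L.+1 -> W}| <= 2 ^ (s * L.+1))%N.
  by move=> Ws; rewrite card_ffun card_ord expnM leq_exp2r.
rewrite /sw_state /copies !card_prod !card_ord.
set E := (_ + _ + _ + _)%N.
have S1' := pow _ _ L1 S1; have S2' := pow _ _ L2 S2.
have H1' := pow _ _ L1 H1; have H2' := pow _ _ L2 H2.
have G1 : (L1.+1 <= 2 ^ L1.+1)%N by rewrite ltnW // ltn_expl.
have G2 : (L2.+1 <= 2 ^ L2.+1)%N by rewrite ltnW // ltn_expl.
apply: (@leq_trans (2 ^ (s1 * L1.+1 + s2 * L2.+1 + (q1 * L1.+1 + (q2 * L2.+1 + q2 * L2.+1)) +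
    (L1.+1 + L2.+1) + (q1 + (q2 + q2))))).
  by rewrite !expnD; repeat (apply: leq_mul => //).
by rewrite leq_exp2l // /E -addnn; lia.
Qed.

Lemma card_ams_seed d T r : #|ams_seed d T r| = (2 ^ (d * r * T.+1))%N.
Proof. by rewrite !card_ffun !card_ord card_mx card_bool mul1n !expnM. Qed.

Lemma card_ams_state M T r l : (M.*2.+1 <= 2 ^ l)%N ->
  (#|ams_state M T r| <= 2 ^ (l * r * T.+1))%N.
Proof.
move=> Ml; rewrite !card_ffun !card_ord !expnM leq_exp2r //.
by case: r => // r; rewrite leq_exp2r.
Qed.

Section Logarithms.
Variable R : realType.

Lemma ln2_ge : 1 / 2 <= ln 2 :> R.
Proof.
have := @le_ln1Dx R (- (1 / 2)) _; rewrite (_ : 1 - 1 / 2 = 2^-1); last by field.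
rewrite lnV ?posrE //.
by move=> H; have := H ltac:(lra); lra.
Qed.

Lemma ln1D_ge (x : R) : 0 < x <= 1 -> x / 2 <= ln (1 + x).
Proof.
move=> /andP[x0 x1]; have p : 0 < 1 + x by lra.
have xp : 0 < x / (1 + x) by rewrite divr_gt0.
have x2 : x / 2 <= x / (1 + x).
  by rewrite ler_pM2l // lef_pV2 ?posrE //; lra.
have x3 : x / (1 + x) < 1 by rewrite ltr_pdivrMr //; lra.
have := @le_ln1Dx R (- (x / (1 + x))) _.
have -> : 1 - x / (1 + x) = (1 + x)^-1 by field; rewrite gt_eqF.
rewrite lnV ?posrE // => H.
have {}H : - ln (1 + x) <= - (x / (1 + x)) by apply: H; lra.
lra.
Qed.

Lemma up_log_le (k : nat) : (0 < k)%N -> (up_log 2 k)%:R <= 1 + 2 * ln k%:R :> R.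
Proof.
case: k => [//|[|k]] _; first by rewrite ln1 up_log1; lra.
have /andP[lo _] := @up_log_bounds 2 k.+2 isT isT.
set l := up_log 2 k.+2 in lo *.
have l0 : (0 < l)%N by rewrite /l up_log_gt0.
have : (2 ^ l.-1)%:R <= k.+2%:R :> R by rewrite ler_nat ltnW.
rewrite -ler_ln ?posrE ?ltr0n ?expn_gt0 // natrX lnXn // -[_ *+ l.-1]mulr_natr => H.
have -> : l%:R = l.-1%:R + 1 :> R by rewrite -[in LHS](prednK l0) -natr1.
have := ler_wpM2r (ler0n R l.-1) ln2_ge; lra.
Qed.

Lemma nat_above (x : R) : 0 <= x -> exists k : nat, x < k%:R <= x + 1.
Proof.
move=> x0; exists (Num.trunc x).+1; have /andP[lo hi] := truncn_itv x0.
by rewrite hi -natr1 lerD2r lo.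
Qed.

Lemma power_above (x X : R) : 0 < x <= 1 -> 1 <= X ->
  exists L : nat, X < (1 + x) ^+ L /\ L%:R <= 2 / x * ln X + 1.
Proof.
move=> x01 X1; have /andP[x0 x1] := x01.
have [|L /andP[lo hi]] := @nat_above (2 / x * ln X).
  by rewrite mulr_ge0 ?ln_ge0 // divr_ge0 // ltW.
exists L; split=> //; rewrite -ltr_ln ?posrE ?exprn_gt0 //; try lra.
rewrite lnXn; last lra.
rewrite -[_ *+ L]mulr_natl.
apply: (@lt_le_trans _ _ (L%:R * (x / 2))); last by rewrite ler_wpM2l ?ler0n // ln1D_ge.
have -> : ln X = (2 / x * ln X) * (x / 2) by field; rewrite gt_eqF.
by rewrite ltr_pM2r // divr_gt0.
Qed.

End Logarithms.

Lemma ler_pM4 (R : realType) (x1 x2 x3 x4 y1 y2 y3 y4 : R) :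
  0 <= x1 -> 0 <= x2 -> 0 <= x3 -> 0 <= x4 ->
  x1 <= y1 -> x2 <= y2 -> x3 <= y3 -> x4 <= y4 ->
  x1 * x2 * x3 * x4 <= y1 * y2 * y3 * y4.
Proof. by move=> *; do 3![apply: ler_pM => //; rewrite ?mulr_ge0 //]. Qed.

Definition space_factor (R : realType) (rho1 rho2 tau : R) : R :=
  1520 * rho1 * tau + 8576 * rho2 * tau + 2752.

Lemma space_factor_gt0 (R : realType) (rho1 rho2 tau : R) :
  0 <= rho1 -> 0 <= rho2 -> 0 <= tau -> 0 < space_factor rho1 rho2 tau.
Proof.
by move=> r1 r2 t; rewrite /space_factor ltr_wpDl ?addr_ge0 ?mulr_ge0.
Qed.

Lemma space_bound (R : realType) (y u t rho1 rho2 tau : R)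
    (d l L1 L2 T r1 r2 : nat) :
  1 <= y -> 1 / 2 <= u -> 1 / 2 <= t ->
  d%:R <= 8 * u -> l%:R <= 12 * u -> L1.+2%:R <= 38 * y * u ->
  L2.+2%:R <= 134 * y ^+ 2 * u -> T%:R <= tau * u * t ->
  r1%:R <= rho1 * y ^+ 4 -> r2%:R <= rho2 * y ^+ 3 ->
  ((d * r1 * T + l * r1 * T) * L1.+2 + (d * r2 * T + (l * r2 * T).*2) * L2.+2
     + L1.+1 + L2.+1)%N%:R
  <= space_factor rho1 rho2 tau * (y ^+ 5 * u ^+ 4 * t).
Proof.
rewrite /space_factor.
move=> y1 u1 t1 dB lB L1B L2B TB r1B r2B.
have y0 : 0 <= y by lra.
have u0 : 0 <= u by lra.
have p k : 0 <= k%:R :> R by exact: ler0n.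
have A1 : (d%:R + l%:R) * r1%:R * T%:R * L1.+2%:R <=
    (20 * u) * (rho1 * y ^+ 4) * (tau * u * t) * (38 * y * u).
  by apply: ler_pM4 => //; [rewrite addr_ge0 | lra].
have A2 : (d%:R + 2 * l%:R) * r2%:R * T%:R * L2.+2%:R <=
    (32 * u) * (rho2 * y ^+ 3) * (tau * u * t) * (134 * y ^+ 2 * u).
  by apply: ler_pM4 => //; [rewrite addr_ge0 ?mulr_ge0 | lra].
have y5 : y ^+ 2 <= y ^+ 5 by apply: ler_weXn2l.
have yy : y <= y ^+ 2 by rewrite -[leLHS]expr1; apply: ler_weXn2l.
have A3 : L1.+1%:R + L2.+1%:R <= 172 * (y ^+ 5 * u).
  have e1 : L1.+1%:R <= L1.+2%:R :> R by rewrite ler_nat.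
  have e2 : L2.+1%:R <= L2.+2%:R :> R by rewrite ler_nat.
  have := ler_wpM2r u0 yy; have := ler_wpM2r u0 y5; lra.
have X0 : 0 <= y ^+ 5 * u by rewrite mulr_ge0 // exprn_ge0.
have u3 : u ^+ 3 <= 2 * u ^+ 4.
  by rewrite [u ^+ 4]exprS mulrA ler_peMl ?exprn_ge0 //; lra.
have A4 : y ^+ 5 * u <= 8 * (y ^+ 5 * u ^+ 3 * t).
  have ut : 1 <= 8 * (u ^+ 2 * t).
    have : 1 / 2 * (1 / 2) <= u ^+ 2 by rewrite expr2; apply: ler_pM; lra.
    move=> uu; have : 1 / 4 * (1 / 2) <= u ^+ 2 * t by apply: ler_pM; lra.
    lra.
  have := ler_wpM2l X0 ut; rewrite mulr1; lra.
have pos : 0 <= rho1 * tau.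
  have : 0 <= rho1.
    have h : 0 <= rho1 * y ^+ 4 by apply: le_trans r1B.
    by rewrite -(pmulr_lge0 _ (exprn_gt0 4 (lt_le_trans ltr01 y1))).
  have h : 0 <= tau * u * t by apply: le_trans TB.
  move=> ?; rewrite mulr_ge0 //.
  rewrite -(pmulr_lge0 _ (_ : 0 < u)); last lra.
  by rewrite -(pmulr_lge0 _ (_ : 0 < t)); last lra.
have pos2 : 0 <= rho2 * tau.
  have : 0 <= rho2.
    have h : 0 <= rho2 * y ^+ 3 by apply: le_trans r2B.
    by rewrite -(pmulr_lge0 _ (exprn_gt0 3 (lt_le_trans ltr01 y1))).
  have h : 0 <= tau * u * t by apply: le_trans TB.
  move=> ?; rewrite mulr_ge0 //.
  rewrite -(pmulr_lge0 _ (_ : 0 < u)); last lra.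
  by rewrite -(pmulr_lge0 _ (_ : 0 < t)); last lra.
pose Z := y ^+ 5 * u ^+ 3 * t.
have Zle : Z <= 2 * (y ^+ 5 * u ^+ 4 * t).
  have := ler_wpM2r (_ : 0 <= t) (ler_wpM2l (exprn_ge0 5 y0) u3); rewrite /Z => /(_ ltac:(lra)); lra.
apply: (@le_trans _ _ ((760 * (rho1 * tau) + 4288 * (rho2 * tau) + 1376) * Z)).
  rewrite -!addnA !natrD !natrM !natrD -muln2 !natrM.
  have -> : (760 * (rho1 * tau) + 4288 * (rho2 * tau) + 1376) * Z =
    (20 * u) * (rho1 * y ^+ 4) * (tau * u * t) * (38 * y * u) +
    (32 * u) * (rho2 * y ^+ 3) * (tau * u * t) * (134 * y ^+ 2 * u) + 172 * (8 * Z).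
    by rewrite /Z; ring.
  rewrite /Z; lra.
have C0 : 0 <= 760 * (rho1 * tau) + 4288 * (rho2 * tau) + 1376 by lra.
have := ler_wpM2l C0 Zle; lra.
Qed.

Lemma ln_le_pred (R : realType) (x : R) : 0 < x -> ln x <= x - 1.
Proof.
move=> x0; have := @le_ln1Dx R (x - 1); rewrite addrCA subrr addr0; apply; lra.
Qed.

Lemma powR_five_half (R : realType) (x : R) : 0 < x ->
  x `^ (- (5 / 2)) = (Num.sqrt x)^-1 ^+ 5.
Proof.
move=> x0; rewrite powRN exprVn; congr (_^-1).
by rewrite mulrC powRrM powR12_sqrt ?(ltW x0) // powR_mulrn // sqrtr_ge0.
Qed.

Section Existence.
Variables (R : realType) (n m d l T L1 L2 r1 r2 B : nat) (b : R).
Hypotheses (m0 : (0 < m)%N) (b0 : 0 < b) (b1 : b < 1).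
Hypothesis dP : (n ^ 3 <= 2 ^ d)%N.
Hypothesis lP : ((m * B).*2.+1 <= 2 ^ l)%N.
Hypothesis cap1 : 4 * ((m * B)%:R ^+ 2) < (1 + b / 2) ^+ L1.
Hypothesis cap2 : 4 * ((m * B)%:R ^+ 2) < (1 + b ^+ 2 / 8) ^+ L2.
Hypothesis r1P : 192 <= r1%:R * (b ^+ 2 / 32) ^+ 2.
Hypothesis r2P : 192 <= r2%:R * (b ^+ 2 * b / (20 * 32 ^+ 2)).
Hypothesis TP : (m * m * (L1.+1 + L2.+1) <= 2 ^ T.+1)%N.

Lemma exists_robust_alg : exists A : stream_alg R n,
  robust_F2 m B (b ^+ 2) A /\
  (space_bits A <= (d * r1 * T.+1 + l * r1 * T.+1) * L1.+2 +
     (d * r2 * T.+1 + (l * r2 * T.+1).*2) * L2.+2 + L1.+1 + L2.+1)%N.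
Proof.
have [z [z2 z4]] := exists_signs R dP.
pose K1 := ams_sketch R (m * B) T r1 z.
pose K2 := ams_sketch R (m * B) T r2 z.
have cop : (0 < #|copies K1 K2 L1 L2|)%N.
  by apply/card_gt0P; exists ([ffun=> [ffun=> [ffun=> 0]]], [ffun=> [ffun=> [ffun=> 0]]]).
exists (switching_alg (b ^+ 2) b cop); split.
  have p2 : 0 < 2 ^+ T.+1 :> R by rewrite exprn_gt0.
  have valP (us : seq (update n)) : valid_stream m B us -> insertion_only us /\ (stream_mass us <= m * B)%N.
    exact: valid_stream_mass.
  apply: (@switching_robust R n K1 K2 L1 L2 (b ^+ 2) b cop m B (2 ^+ T.+1)^-1) => //.
  - by rewrite invr_ge0 ltW.
  - apply: (ams_accurate T z2 z4 _ r1P valP).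
    by rewrite exprn_gt0 // divr_gt0 // exprn_gt0.
  - apply: (ams_accurate T z2 z4 _ r2P valP).
    by rewrite divr_gt0 // mulr_gt0 // exprn_gt0.
  have mR : 0 < m%:R :> R by rewrite ltr0n.
  rewrite ler_pdivrMr // mulrC ler_pdivlMr // mulrC -natrM -natrX ler_nat mulnA.
  exact: TP.
rewrite /space_bits; apply: up_log_min => //; apply: card_sw_state.
- by rewrite card_ams_seed.
- exact: card_ams_state.
- by rewrite card_ams_seed.
- exact: card_ams_state.
Qed.

End Existence.

Section Sizes.
Variable R : realType.

Lemma sign_bits (n : nat) (u : R) : (0 < n)%N -> 1 / 2 <= u -> ln n%:R <= u ->
  exists d, (n ^ 3 <= 2 ^ d)%N /\ d%:R <= 8 * u.
Proof.
move=> n0 u1 lnn; exists (up_log 2 (n ^ 3)); split; first exact: up_logP.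
apply: le_trans (up_log_le R _) _; first by rewrite expn_gt0 n0.
by rewrite natrX lnXn ?ltr0n // -[_ *+ 3]mulr_natl; lra.
Qed.

Lemma counter_bits (M : nat) (u : R) : (0 < M)%N -> 1 / 2 <= u -> ln M%:R <= u ->
  exists l, (M.*2.+1 <= 2 ^ l)%N /\ l%:R <= 12 * u.
Proof.
move=> M0 u1 lnM_le; exists (up_log 2 M.*2.+1); split; first exact: up_logP.
apply: le_trans (up_log_le R _) _ => //.
have : ln (M.*2.+1)%:R <= ln (3 * M%:R) :> R.
  by rewrite ler_ln ?posrE ?mulr_gt0 ?ltr0n // -natrM ler_nat; lia.
rewrite lnM ?posrE ?ltr0n //; have := @ln_le_pred R 3 ltac:(lra); lra.
Qed.

Lemma copy_count (M : nat) (u x : R) : (0 < M)%N -> 1 / 2 <= u -> ln M%:R <= u ->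
  0 < x <= 1 ->
  exists L, 4 * (M%:R ^+ 2) < (1 + x) ^+ L /\ L%:R <= 16 * x^-1 * u + 1.
Proof.
move=> M0 u1 lnM_le x01; have /andP[x0 _] := x01.
have M1 : 1 <= M%:R ^+ 2 :> R by rewrite exprn_ege1 // ler1n.
have [|L [cap LB]] := @power_above R x (4 * (M%:R ^+ 2)) x01; first lra.
exists L; split=> //; apply: le_trans LB _; rewrite lerD2r.
have -> : 16 * x^-1 * u = 2 / x * (8 * u) by ring.
apply: ler_wpM2l; first by rewrite divr_ge0 // ltW.
rewrite lnM ?posrE ?exprn_gt0 ?ltr0n // lnXn ?ltr0n // -[_ *+ 2]mulr_natl.
have := @ln_le_pred R 4 ltac:(lra); lra.
Qed.

Lemma row_count (w x : R) : 0 < w -> 192 / w <= x -> exists r : nat,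
  192 <= r%:R * w /\ r%:R <= x + 1.
Proof.
move=> w0 wx; have [|r /andP[lo hi]] := @nat_above R (192 / w).
  by rewrite divr_ge0 // ltW.
exists r; split; last by apply: le_trans hi _; rewrite lerD2r.
by rewrite -ler_pdivrMr // ltW.
Qed.

Definition group_factor (c : R) : R := 20 + 8 * ln (1376 * c).

Lemma group_count (m L : nat) (y c lam g t : R) :
  (0 < m)%N -> (0 < L)%N -> 1 <= y -> 1 <= c -> 1 / 2 <= lam -> ln m%:R = lam ->
  g = y ^+ 5 * lam ^+ 4 -> t = ln (2 + g) -> 1 / 2 <= t ->
  L%:R <= 172 * y ^+ 2 * (c * lam) ->
  exists T, (m * m * L <= 2 ^ T.+1)%N /\ T.+1%:R <= group_factor c * (c * lam) * t.
Proof.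
move=> m0 L0 y1 c1 lam1 lnm gE tE t1 LB.
have lam0 : 0 <= lam by lra.
have c0 : 0 <= c by lra.
have y0 : 0 <= y by lra.
have lnc : 0 <= ln (1376 * c) by apply: ln_ge0; lra.
have g0 : 0 <= g by rewrite gE mulr_ge0 // exprn_ge0.
have {}LB : L%:R <= 1376 * c * (2 + g).
  have y25 : y ^+ 2 <= y ^+ 5 by apply: ler_weXn2l.
  have l4 : lam <= 8 * lam ^+ 4.
    have : (1 / 2) ^+ 3 <= lam ^+ 3 by apply: lerXn2r; rewrite ?nnegrE //; lra.
    move=> h; have := ler_wpM2l lam0 h; lra.
  have y2l : y ^+ 2 * lam <= 8 * g.
    rewrite gE mulrCA; apply: ler_pM => //; exact: exprn_ge0.
  have := ler_wpM2l c0 y2l; lra.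
have lnL : ln L%:R <= ln (1376 * c) + t.
  rewrite tE -lnM ?posrE ?ler_ln ?posrE ?ltr0n ?mulr_gt0 //; lra.
pose X := (m * m * L)%N.
have X0 : (0 < X)%N by rewrite !muln_gt0 m0.
exists (up_log 2 X); split.
  by apply: leq_trans (@up_logP 2 X isT) _; rewrite leq_exp2l.
have := up_log_le R X0; rewrite -[(up_log 2 X).+1]addn1 natrD.
rewrite /X !natrM !lnM ?posrE ?mulr_gt0 ?ltr0n // lnm /group_factor.
have lamu : lam <= c * lam by rewrite ler_peMl.
have u1 := le_trans lam1 lamu.
have h0 : 0 <= 1 / 2 :> R by rewrite divr_ge0.
have t0 := le_trans h0 t1.
have ut : 1 / 2 * (1 / 2) <= (c * lam) * t by apply: ler_pM.
have ut2 : c * lam * (1 / 2) <= (c * lam) * t by rewrite ler_wpM2l // mulr_ge0.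
have ut3 : 1 / 2 * t <= (c * lam) * t by rewrite ler_wpM2r.
have := ler_wpM2l lnc ut.
lra.
Qed.

Definition space_const (c : R) : R :=
  space_factor (192 * 32 ^+ 2 + 1) (192 * (20 * 32 ^+ 2) + 1) (group_factor c) * c ^+ 4.

Lemma space_const_gt0 (c : R) : 1 <= c -> 0 < space_const c.
Proof.
move=> c1; have lnc : 0 <= ln (1376 * c) by apply: ln_ge0; lra.
rewrite mulr_gt0 ?exprn_gt0 //; last lra.
by apply: space_factor_gt0; rewrite ?addr_ge0 ?mulr_ge0 ?exprn_ge0.
Qed.

Lemma exists_robust_bits (n m B : nat) (b y c lam g t : R) :
  (0 < n)%N -> (0 < m)%N -> (0 < B)%N -> 0 < b -> b < 1 -> y = b^-1 ->
  1 <= c -> 1 / 2 <= lam -> ln m%:R = lam -> ln n%:R <= c * lam ->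
  ln (m * B)%:R <= c * lam -> g = y ^+ 5 * lam ^+ 4 -> t = ln (2 + g) ->
  exists A : stream_alg R n, robust_F2 m B (b ^+ 2) A /\
    (space_bits A)%:R <= space_const c * (g * t).
Proof.
move=> n0 m0 B0 b0 b1 yE c1 lam1 lnm lnn lnM_le gE tE.
have y1 : 1 <= y by rewrite yE invf_ge1 // ltW.
have y0 : 0 <= y by lra.
have lam0 : 0 <= lam by lra.
have g0 : 0 <= g by rewrite gE mulr_ge0 // exprn_ge0.
have t1 : 1 / 2 <= t by rewrite tE; apply: le_trans (ln2_ge R) _; rewrite ler_ln ?posrE; lra.
have [u uE] : exists u, u = c * lam by exists (c * lam).
have lamu : lam <= u by rewrite uE ler_peMl.
have u1 : 1 / 2 <= u by lra.
have M0 : (0 < m * B)%N by rewrite muln_gt0 m0.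
rewrite -uE in lnn lnM_le.
have [d [dP dB]] := sign_bits n0 u1 lnn.
have [l [lP lB]] := counter_bits M0 u1 lnM_le.
have yu : 1 / 2 <= y * u by rewrite -[1 / 2]mul1r; apply: ler_pM => //; lra.
have y2 : y <= y ^+ 2 by rewrite expr2 ler_peMl.
have y2u : y * u <= y ^+ 2 * u by apply: ler_wpM2r => //; lra.
have b21 : b ^+ 2 <= 1 by rewrite expr_le1 // ltW.
have b20 : 0 < b ^+ 2 by rewrite exprn_gt0.
have [|L1 [cap1 L1B]] := @copy_count _ u (b / 2) M0 u1 lnM_le; first lra.
have [|L2 [cap2 L2B]] := @copy_count _ u (b ^+ 2 / 8) M0 u1 lnM_le; first lra.
have {}L1B : L1.+2%:R <= 38 * y * u.
  have : 16 * (b / 2)^-1 * u = 32 * y * u by rewrite yE; field; rewrite gt_eqF.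
  rewrite -[L1.+2]addn2 natrD; lra.
have {}L2B : L2.+2%:R <= 134 * y ^+ 2 * u.
  have : 16 * (b ^+ 2 / 8)^-1 * u = 128 * y ^+ 2 * u by rewrite yE; field; rewrite gt_eqF.
  rewrite -[L2.+2]addn2 natrD; lra.
have [||T [TP TB]] := @group_count m (L1.+1 + L2.+1) y c lam g t m0 _ y1 c1 lam1 lnm gE tE t1.
- by rewrite addSn.
- rewrite -uE natrD -[L1.+1]addn1 -[L2.+1]addn1 !natrD.
  by move: L1B L2B; rewrite -[L1.+2]addn2 -[L2.+2]addn2 !natrD; lra.
rewrite -uE in TB.
have ypow k : 1 <= y ^+ k by rewrite exprn_ege1.
have [|r1 [r1P r1B]] := @row_count ((b ^+ 2 / 32) ^+ 2) (192 * 32 ^+ 2 * y ^+ 4)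
    (exprn_gt0 2 (divr_gt0 b20 (ltr0n R 32))).
  by rewrite yE le_eqVlt; apply/orP; left; apply/eqP; field; rewrite gt_eqF.
have w0 : 0 < b ^+ 2 * b / (20 * 32 ^+ 2) by rewrite divr_gt0 // mulr_gt0 // exprn_gt0.
have [|r2 [r2P r2B]] := @row_count _ (192 * (20 * 32 ^+ 2) * y ^+ 3) w0.
  by rewrite yE le_eqVlt; apply/orP; left; apply/eqP; field; rewrite gt_eqF.
have {}r1B : r1%:R <= (192 * 32 ^+ 2 + 1) * y ^+ 4.
  by apply: le_trans r1B _; rewrite [leRHS]mulrDl; apply: lerD; rewrite ?[leRHS]mul1r.
have {}r2B : r2%:R <= (192 * (20 * 32 ^+ 2) + 1) * y ^+ 3.
  by apply: le_trans r2B _; rewrite [leRHS]mulrDl; apply: lerD; rewrite ?[leRHS]mul1r.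
have [A [Arob Aspace]] := exists_robust_alg m0 b0 b1 dP lP cap1 cap2 r1P r2P TP.
exists A; split=> //.
apply: (@le_trans _ _ (_%N)%:R); first by rewrite ler_nat; exact: Aspace.
apply: le_trans (space_bound y1 u1 t1 dB lB L1B L2B TB r1B r2B) _.
rewrite gE uE exprMn /space_const le_eqVlt; apply/orP; left; apply/eqP.
set f := space_factor _ _ _; ring.
Qed.

End Sizes.

Lemma admissible_robust_bits (R : realType) (c1 c2 : R) (K n m : nat) (alpha : R) :
  0 < c1 -> admissible c1 c2 n m alpha ->
  exists A : stream_alg R n, robust_F2 m (n ^ K)%N alpha A /\
    (space_bits A)%:R <= space_const (1 + c1^-1 + K%:R / c1) *
      (alpha `^ (- (5 / 2)) * ln m%:R ^+ 4 * ln (2 + alpha `^ (- (5 / 2)) * ln m%:R ^+ 4)).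
Proof.
move=> hc [n1 m1 /andP[nm _] /andP[a0 a1]].
have ic0 : 0 < c1^-1 by rewrite invr_gt0.
have Kc0 : 0 <= K%:R / c1 by rewrite divr_ge0 // ltW.
have n0 : (0 < n)%N by exact: ltnW.
have m0 : (0 < m)%N by exact: ltnW.
have B0 : (0 < n ^ K)%N by rewrite expn_gt0 n0.
have [lam lamE] : exists lam, ln m%:R = lam :> R by exists (ln m%:R).
have lam1 : 1 / 2 <= lam.
  by rewrite -lamE; apply: le_trans (ln2_ge R) _; rewrite ler_ln ?posrE ?ltr0n ?ler_nat.
have lam0 : 0 <= lam by lra.
have lnn : ln n%:R <= c1^-1 * lam.
  by rewrite -(ler_pM2l hc) mulrA divff ?gt_eqF // mul1r -lamE.
have lam_ge0 : 0 <= c1^-1 * lam by rewrite mulr_ge0 // ltW.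
have Klam : 0 <= K%:R / c1 * lam by rewrite mulr_ge0.
rewrite powR_five_half // -[alpha in robust_F2 _ _ alpha](sqr_sqrtr (ltW a0)).
apply: (@exists_robust_bits R n m (n ^ K) (Num.sqrt alpha) (Num.sqrt alpha)^-1 _ lam);
  rewrite ?sqrtr_gt0 ?lamE //.
- by rewrite -[1]sqrtr1 ltr_sqrt.
- lra.
- lra.
rewrite natrM lnM ?posrE ?ltr0n // natrX lnXn ?ltr0n // -[_ *+ K]mulr_natl lamE.
have := ler_wpM2l (ler0n R K) lnn; lra.
Qed.

Theorem theorem4p6 (R : realType) (c1 c2 : R) (K : nat)
    (hc1 : 0 < c1) (hc2 : 0 < c2) :
  exists A : forall (n m : nat) (alpha : R), stream_alg R n,
    (forall (n m : nat) (alpha : R), admissible c1 c2 n m alpha ->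
       robust_F2 m (n ^ K)%N alpha (A n m alpha)) /\
    soft_O (fun p : nat * nat * R => admissible c1 c2 p.1.1 p.1.2 p.2)
      (fun p : nat * nat * R => (space_bits (A p.1.1 p.1.2 p.2))%:R)
      (fun p : nat * nat * R => p.2 `^ (- (5 / 2)) * ln p.1.2%:R ^+ 4).
Proof.
have unit_gt0 : (0 < #|{: unit}|)%N by rewrite card_unit.
have exA n m alpha : exists A : stream_alg R n, admissible c1 c2 n m alpha ->
    robust_F2 m (n ^ K)%N alpha A /\
    (space_bits A)%:R <= space_const (1 + c1^-1 + K%:R / c1) *
      (alpha `^ (- (5 / 2)) * ln m%:R ^+ 4 * ln (2 + alpha `^ (- (5 / 2)) * ln m%:R ^+ 4)).
  have [/(admissible_robust_bits K hc1)[A ?]|nadm] := pselect (admissible c1 c2 n m alpha); first by exists A.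
  by exists (seeded_alg id (fun _ _ => tt) (fun _ => 0) unit_gt0) => /nadm.
exists (fun n m alpha => sval (cid (exA n m alpha))); split.
  by move=> n m alpha /(svalP (cid (exA n m alpha)))[].
exists (space_const (1 + c1^-1 + K%:R / c1)), 1%N; split=> [|p].
  apply: space_const_gt0; rewrite -addrA lerDl addr_ge0 ?divr_ge0 ?invr_ge0 ?ler0n //;
    exact: ltW.
move=> /(svalP (cid (exA p.1.1 p.1.2 p.2)))[_].
by rewrite expr1.
Qed.
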